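(* Let $S\subset\mathbb{N}^\times\setminus\{1\}$ be a family of pairwise relatively prime natural numbers and $P=\langle S\rangle\subset\mathbb{N}^\times$ the monoid generated by $S$, acting on $\mathbb{Z}$ by multiplication. For $\emptyset\neq S'\subset S$, let $Q=\langle S\setminus S'\rangle\subset\mathbb{N}^\times$, let $R=\widehat{Q^{-1}Q}$ be the Pontryagin dual of the Grothendieck group of $Q$, and let $\mathcal{A}_{S'}=C^*(\{u^ks_p\mid p\in S',\ 0\leq k\leq p-1\})\subset\mathcal{Q}(\mathbb{Z}\rtimes P)$. Then ${\rm Aut}_{\mathcal{A}_{S'}}\mathcal{Q}(\mathbb{Z}\rtimes P)$ is isomorphic to the group of gauge automorphisms of $R$ on $\mathcal{Q}(\mathbb{Z}\rtimes Q)$. In particular, the only automorphism of $\mathcal{Q}(\mathbb{Z}\rtimes P)$ that fixes the torsion subalgebra $\mathcal{A}_S$ pointwise is the identity.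
   Context: For a submonoid $P\subset\mathbb{N}^\times$ generated by a family of pairwise relatively prime numbers, $\mathcal{Q}(\mathbb{Z}\rtimes P)$ is the universal $C^*$-algebra generated by a unitary $u$ and isometries $s_p$, $p\in P$, with $s_ps_q=s_{pq}$ and $s_1=1$, subject to (I) $s_pu^m=u^{pm}s_p$ for $m\in\mathbb{Z}$; (II) $s_p^*u^ms_q=u^{m_1}s_{p'}s_{q'}^*u^{m_2}$ if $m=pm_1+qm_2$ and $pP\cap qP=pp'P$, $pp'=qq'$, and $s_p^*u^ms_q=0$ if $m\notin p\mathbb{Z}+q\mathbb{Z}$; (III) $\sum_{m=0}^{p-1}u^ms_ps_p^*u^{-m}=1$ for all $p\in P$. For a $C^*$-subalgebra $B$, ${\rm Aut}_B\mathcal{Q}(\mathbb{Z}\rtimes P)$ is the group of $*$-automorphisms fixing $B$ pointwise. The gauge automorphisms of $R$ on $\mathcal{Q}(\mathbb{Z}\rtimes Q)$ are the automorphisms $\gamma_\chi$, $\chi\in R$, with $\gamma_\chi(u)=u$ and $\gamma_\chi(s_q)=\chi(q)s_q$ for $q\in Q$. The torsion subalgebra is $\mathcal{A}_S=C^*(\{u^ks_p\mid p\in S,\ 0\leq k\leq p-1\})$. *)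

(* Defs.v *)
From HB Require Import structures.
From mathcomp Require Import all_boot all_order all_algebra.
From mathcomp Require Import all_classical all_reals all_analysis.
From mathcomp Require Import complex.

Set Implicit Arguments.
Unset Strict Implicit.
Unset Printing Implicit Defensive.
Import Order.TTheory GRing.Theory Num.Theory numFieldNormedType.Exports.

Local Open Scope classical_set_scope.
Local Open Scope ring_scope.

(* Unital complex C*-algebras. The norm is axiomatised over [algType R[i]]
   because the hierarchy has no common substructure of rings and normed modules
   below numeric domains, so that the two cannot be joined. As [algType] is
   built on nontrivial rings, the zero algebra is excluded. *)
HB.mixin Record isCStarAlgebra (R : realType) (A : Type)
    of GRing.Algebra R[i] A := {
  cnorm : A -> R;
  star : A -> A;
  cnorm_eq0 : forall x : A, cnorm x = 0 -> x = 0;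
  cnormD_le : forall x y : A, cnorm (x + y) <= cnorm x + cnorm y;
  cnormZ : forall (c : R[i]) (x : A),
    cnorm (c *: x) = ComplexField.Normc.normc c * cnorm x;
  cnormM_le : forall x y : A, cnorm (x * y) <= cnorm x * cnorm y;
  cnorm_complete : forall x : nat -> A,
    (forall e : R, 0 < e -> exists N : nat, forall m n : nat,
       (N <= m)%N -> (N <= n)%N -> cnorm (x m - x n) < e) ->
    exists l : A, forall e : R, 0 < e -> exists N : nat, forall n : nat,
      (N <= n)%N -> cnorm (x n - l) < e;
  starK : forall x : A, star (star x) = x;
  starD : forall x y : A, star (x + y) = star x + star y;
  starZ : forall (c : R[i]) (x : A), star (c *: x) = Num.conj c *: star x;
  starM : forall x y : A, star (x * y) = star y * star x;
  cstar_norm : forall x : A, cnorm (star x * x) = cnorm x ^+ 2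
}.

#[short(type="cstarAlgType")]
HB.structure Definition CStarAlgebra (R : realType) :=
  {A of isCStarAlgebra R A & GRing.Algebra R[i] A}.

Notation "x ^`*" := (star x) (at level 1, format "x ^`*") : ring_scope.

Section StarAlgebra.
Variable R : realType.
Implicit Types A B : cstarAlgType R.

Definition star_hom A B (f : A -> B) : Prop :=
  [/\ linear f, f 1 = 1, {morph f : x y / x * y} & {morph f : x / x^`*}].

Definition star_aut A : set (A -> A) :=
  [set f | star_hom f /\ bijective f].

Definition norm_closed A (M : set A) : Prop :=
  forall x, (forall e : R, 0 < e -> exists2 y, M y & cnorm (x - y) < e) -> M x.

(* C*-subalgebras are not required to contain the unit. *)
Definition cstar_subalgebra A : set (set A) :=
  [set M | [/\ M 0,
     (forall (c : R[i]) x y, M x -> M y -> M (c *: x + y)),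
     (forall x y, M x -> M y -> M (x * y)),
     (forall x, M x -> M x^`*) & norm_closed M]].

Definition cstar_generated A (G : set A) : set A :=
  smallest (@cstar_subalgebra A) G.

Definition star_aut_fixing A (M : set A) : set (A -> A) :=
  [set f | @star_aut A f /\ forall x, M x -> f x = x].

(* Integral powers of a unitary [u], whose inverse is [u^`*]. *)
Definition zpow A (u : A) (m : int) : A :=
  match m with Posz n => u ^+ n | Negz n => u^`* ^+ n.+1 end.

End StarAlgebra.

(* For groups of bijections under composition, given as sets of maps. *)
Definition group_isomorphic (T U : Type) (G : set (T -> T)) (H : set (U -> U))
    : Prop :=
  exists Phi : (T -> T) -> (U -> U),
    set_bij G H Phi /\
    forall f g, G f -> G g -> Phi (f \o g) = Phi f \o Phi g.

Definition nat_submonoid : set (set nat) :=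
  [set M | M 1%N /\ forall p q, M p -> M q -> M (p * q)%N].

Definition monoid_generated (S : set nat) : set nat :=
  smallest nat_submonoid S.

Definition principal_ideal (P : set nat) (p : nat) : set nat :=
  [set (p * x)%N | x in P].

Section BoundaryQuotient.
Variable R : realType.
Implicit Types A B : cstarAlgType R.

(* The values of [s] outside [P] play no role. *)
Record boundary_relations (P : set nat) A (u : A) (s : nat -> A) : Prop := {
  br_unitary_l : u^`* * u = 1;
  br_unitary_r : u * u^`* = 1;
  br_isometry : forall p, P p -> (s p)^`* * s p = 1;
  br_mul : forall p q, P p -> P q -> s p * s q = s (p * q)%N;
  br_one : s 1%N = 1;
  br_I : forall p (m : int), P p ->
    s p * zpow u m = zpow u (p%:Z * m) * s p;
  br_II : forall (p q p' q' : nat) (m m1 m2 : int),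
    P p -> P q -> P p' -> P q' ->
    m = p%:Z * m1 + q%:Z * m2 ->
    principal_ideal P p `&` principal_ideal P q
      = principal_ideal P (p * p')%N ->
    (p * p' = q * q')%N ->
    (s p)^`* * zpow u m * s q
      = zpow u m1 * s p' * (s q')^`* * zpow u m2;
  br_II0 : forall (p q : nat) (m : int), P p -> P q ->
    (~ exists m1 m2 : int, m = p%:Z * m1 + q%:Z * m2) ->
    (s p)^`* * zpow u m * s q = 0;
  br_III : forall p, P p ->
    \sum_(m < p) zpow u m%:Z * s p * (s p)^`* * zpow u (- m%:Z) = 1
}.

(* [A] with [u] and [s] is the C*-algebra Q(Z x| P). *)
Record boundary_quotient (P : set nat) A (u : A) (s : nat -> A) : Prop := {
  bq_relations : boundary_relations P u s;
  bq_generated :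
    cstar_generated ([set u] `|` [set s p | p in P]) = [set: A];
  bq_universal : forall B (v : B) (t : nat -> B), boundary_relations P v t ->
    exists phi : A -> B,
      [/\ star_hom phi, phi u = v, forall p, P p -> phi (s p) = t p
        & forall psi : A -> B, star_hom psi -> psi u = v ->
            (forall p, P p -> psi (s p) = t p) -> psi = phi]
}.

Definition torsion_subalgebra (S : set nat) A (u : A) (s : nat -> A) : set A :=
  cstar_generated
    [set x | exists p k, [/\ S p, (k <= p - 1)%N & x = u ^+ k * s p]].

(* Q^{-1}Q, realised inside the multiplicative group of positive rationals. *)
Definition grothendieck_group (Q : set nat) : set rat :=
  [set x | exists a b, [/\ Q a, Q b & x = a%:R / b%:R]].

(* The values of a character outside Q^{-1}Q play no role. *)
Definition pontryagin_dual (Q : set nat) : set (rat -> R[i]) :=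
  [set chi | (forall x, grothendieck_group Q x -> `|chi x| = 1) /\
     (forall x y, grothendieck_group Q x -> grothendieck_group Q y ->
        chi (x * y) = chi x * chi y)].

Definition gauge_automorphisms (Q : set nat) A (u : A) (s : nat -> A)
    : set (A -> A) :=
  [set f | @star_aut R A f /\
     exists2 chi, pontryagin_dual Q chi &
       f u = u /\ forall q, Q q -> f (s q) = chi q%:R *: s q].

End BoundaryQuotient.

(* Main.v *)
Require Import Defs.
From mathcomp Require Import all_boot all_order all_algebra all_solvable all_field.
From mathcomp Require Import all_classical all_reals all_analysis.
From mathcomp Require Import complex.
From mathcomp Require Import ring lra zify.

Set Implicit Arguments.
Unset Strict Implicit.
Unset Printing Implicit Defensive.
Import Order.TTheory GRing.Theory Num.Theory numFieldNormedType.Exports.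

(** An automorphism [f] of [Q(Z x| P)] that fixes the isometries [u^k s_p],
    [0 <= k < p], for one [p > 1] in [P] is shown to be a gauge automorphism,
    and this gives both claims.

    First, [f u = u] ([endo_fixes_unitary]).  The element [x = f u u^* - 1]
    commutes with [s_p] and kills [u^k s_p] for [0 < k < p]; hence it kills
    [u^M s_p^n] whenever [0 < M < p^n].  In the representation on [l^2(Z)]
    such an [x] is a multiple of the projection onto [e_0], and [x] should
    vanish because the algebra contains no compact operator.  To see this in
    the abstract algebra, approximate [x] by a combination [y] of the elements
    [u^a s_r s_q^* u^b], which span a dense subalgebra ([term_span_dense]).  If
    all the quotients [r / q] agree then [y u^M = u^e y] for a suitable [M > 0],
    so that [y s_p^n] has the norm of [y u^M s_p^n], which is close to
    [x u^M s_p^n = 0]; as [x] commutes with the isometry [s_p], the norm of [x]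
    is at most twice the error ([defect_homogeneous]).  The general case follows
    by Fourier analysis for the gauge actions [s_r |-> z^(v_j r) s_r], where
    [v_j] is the valuation at a prime [j]: Fejer means are contractions, they
    converge on combinations of terms, and they express a mean of [x] by a
    number of homogeneous components of [x] that does not depend on how well
    [y] approximates [x] ([stable_subspace_zero]).  This is where the
    amenability of the free abelian group [P^-1 P] enters.

    Secondly, [f (s_q)] is a scalar multiple of [s_q] ([intertwiner_scalar]).
    The element [t = f (s_q)] satisfies [t u = u^q t] and [t s_p = s_p t], hence
    [t = s_g^* u^(-qM) t u^M s_g] for [g = p^n] and all [M].  For [M], and then
    [n], large, this corner of a term [u^a s_r s_q'^* u^b] vanishes unless
    [r = q q'] and [a = - q b], that is unless the term is [s_q] times a
    diagonal projection; averaging over translations by powers of [u] turns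
    that projection into a scalar.  So [t] is a limit of multiples of [s_q].

    The scalars form a character of [P] that is trivial on [S'].  Conversely a
    character of [<S \ S'>] extends to [P] by the value [1] on [S'], as the
    members of [S] are pairwise coprime ([multiplicative_extend]), and the
    universal property realises it on either algebra.  The isomorphism matches
    automorphisms with the same character. *)

(** * Norms in C*-algebras *)

Section CStarBasics.
Local Open Scope classical_set_scope.
Local Open Scope ring_scope.
Variables (R : realType) (A : cstarAlgType R).
Implicit Types (x y z : A) (c : R[i]).

Notation normc := ComplexField.Normc.normc.

Lemma normc_eqP c (r : R) : (normc c = r) <-> `|c| = (r%:C)%C.
Proof.
split=> [<- //|H].
have : ((normc c)%:C)%C = (r%:C)%C by rewrite -H.
by case.
Qed.

Lemma normc_unit c : `|c| = 1 -> normc c = 1.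
Proof. by move=> H; apply/normc_eqP; rewrite H. Qed.

Lemma normc_ge0 c : 0 <= normc c.
Proof. by have := normr_ge0 c; rewrite lecR. Qed.

Lemma normc_real (r : R) : normc (r%:C)%C = `|r|.
Proof. by rewrite /= expr0n addr0 sqrtr_sqr. Qed.

Lemma normc_natV n : normc (n%:R^-1 : R[i]) = n%:R^-1.
Proof.
have -> : n%:R^-1 = (n%:R^-1)%:C%C :> R[i] by rewrite fmorphV rmorph_nat.
by rewrite normc_real ger0_norm // invr_ge0 ler0n.
Qed.

Lemma cnorm0 : cnorm (0 : A) = 0.
Proof. by rewrite -(scale0r (0 : A)) cnormZ ComplexField.Normc.normc0 mul0r. Qed.

Lemma cnormN x : cnorm (- x) = cnorm x.
Proof.
rewrite -scaleN1r cnormZ; have -> : normc (-1 : R[i]) = 1.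
  by apply: normc_unit; rewrite normrN1.
by rewrite mul1r.
Qed.

Lemma cnorm_ge0 x : 0 <= cnorm x.
Proof.
have := cnormD_le x (- x); rewrite subrr cnorm0 cnormN => h; lra.
Qed.

Lemma cnormBC x y : cnorm (x - y) = cnorm (y - x).
Proof. by rewrite -cnormN opprB. Qed.

Lemma cnormB_le x y : cnorm (x - y) <= cnorm x + cnorm y.
Proof. by rewrite -[cnorm y]cnormN cnormD_le. Qed.

Lemma cnorm_triangle z x y : cnorm (x - y) <= cnorm (x - z) + cnorm (z - y).
Proof. by have := cnormD_le (x - z) (z - y); rewrite addrA subrK. Qed.

Lemma cnorm_sum (I : Type) (r : seq I) (P : pred I) (F : I -> A) :
  cnorm (\sum_(i <- r | P i) F i) <= \sum_(i <- r | P i) cnorm (F i).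
Proof.
elim/big_ind2: _ => [|a b d e h1 h2|//]; first by rewrite cnorm0.
by apply: le_trans (cnormD_le _ _) _; apply: lerD.
Qed.

Lemma cnorm_small x : (forall e : R, 0 < e -> cnorm x <= e) -> x = 0.
Proof.
move=> H; apply: cnorm_eq0; apply/eqP; rewrite eq_le cnorm_ge0 andbT.
by apply/ler_addgt0Pl => e e0; rewrite addr0 H.
Qed.

Lemma star0 : (0 : A)^`* = 0.
Proof. by have := starD (0 : A) 0; rewrite addr0 => /eqP; rewrite -subr_eq subrr => /eqP. Qed.

Lemma starN x : (- x)^`* = - x^`*.
Proof. by rewrite -scaleN1r starZ rmorphN1 scaleN1r. Qed.

Lemma starB x y : (x - y)^`* = x^`* - y^`*.
Proof. by rewrite starD starN. Qed.

Lemma star1 : (1 : A)^`* = 1.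
Proof. by have := starM (1 : A)^`* 1; rewrite !mulr1 !starK mulr1. Qed.

Lemma star_sum (I : Type) (r : seq I) (P : pred I) (F : I -> A) :
  (\sum_(i <- r | P i) F i)^`* = \sum_(i <- r | P i) (F i)^`*.
Proof. by apply: (big_morph _ starD star0). Qed.

Lemma cnorm_star x : cnorm x^`* = cnorm x.
Proof.
suff le y : cnorm y <= cnorm y^`*.
  by apply/eqP; rewrite eq_le le andbT -{2}(starK x) le.
have := cnorm_ge0 y; rewrite le_eqVlt => /predU1P[<-|y0]; first exact: cnorm_ge0.
by rewrite -(ler_pM2r y0) -expr2 -cstar_norm cnormM_le.
Qed.

Lemma cnorm_isometryM (v x : A) : v^`* * v = 1 -> cnorm (v * x) = cnorm x.
Proof.
move=> v1; apply: (pexpIrn (n := 2)); rewrite ?nnegrE ?cnorm_ge0 //.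
by rewrite -!cstar_norm starM mulrA -(mulrA x^`*) v1 mulr1.
Qed.

Lemma cnorm1 : cnorm (1 : A) = 1.
Proof.
have n0 : cnorm (1 : A) != 0.
  by apply/eqP => /cnorm_eq0 /eqP; rewrite oner_eq0.
have := cstar_norm (1 : A); rewrite star1 mulr1 expr2 => h.
by apply: (mulfI n0); rewrite -h mulr1.
Qed.

Lemma cnorm_isometry (v : A) : v^`* * v = 1 -> cnorm v = 1.
Proof. by move=> v1; rewrite -(mulr1 v) cnorm_isometryM // cnorm1. Qed.

Lemma cnormM_le1 (v x w : A) : cnorm v <= 1 -> cnorm w <= 1 ->
  cnorm (v * x * w) <= cnorm x.
Proof.
move=> v1 w1; apply: le_trans (cnormM_le _ _) _.
apply: le_trans (ler_piMr (cnorm_ge0 _) w1) _.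
apply: le_trans (cnormM_le _ _) _; exact: ler_piMl (cnorm_ge0 _) v1.
Qed.

(** Banach's fixed point theorem, inside a closed subset of the algebra. *)
Lemma contraction_fixpoint (K : set A) (F : A -> A) (rho : R) (x0 : A) :
  norm_closed K -> 0 <= rho -> rho < 1 -> K x0 ->
  (forall x, K x -> K (F x)) ->
  (forall x y, K x -> K y -> cnorm (F x - F y) <= rho * cnorm (x - y)) ->
  exists2 x, K x & F x = x.
Proof.
move=> clK r0 r1 Kx0 FK FL.
pose X n := iter n F x0.
have KX n : K (X n) by elim: n => //= n; apply: FK.
pose C := cnorm (F x0 - x0).
have C0 : 0 <= C by exact: cnorm_ge0.
have step n : cnorm (X n.+1 - X n) <= rho ^+ n * C.
  elim: n => [|n IH]; first by rewrite expr0 mul1r.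
  rewrite exprS -mulrA; apply: le_trans (FL _ _ (KX n.+1) (KX n)) _.
  exact: ler_wpM2l.
have r1' : 0 < 1 - rho by rewrite subr_gt0.
have far n k : cnorm (X (n + k)%N - X n) <= rho ^+ n * C / (1 - rho).
  suff : cnorm (X (n + k)%N - X n) <= rho ^+ n * C * (1 - rho ^+ k) / (1 - rho).
    move=> h; apply: le_trans h _; rewrite ler_pM2r ?invr_gt0 //.
    apply: ler_piMr; first by rewrite mulr_ge0 ?exprn_ge0.
    by rewrite lerBlDr lerDl exprn_ge0.
  elim: k => [|k IH].
    by rewrite addn0 subrr cnorm0 expr0 subrr mulr0 mul0r.
  apply: le_trans (cnorm_triangle (X (n + k)%N) _ _) _.
  have h := step (n + k)%N; rewrite addnS.
  apply: le_trans (lerD h IH) _.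
  rewrite exprD exprS.
  have -> : rho ^+ n * C * (1 - rho * rho ^+ k) / (1 - rho)
     = rho ^+ n * rho ^+ k * C + rho ^+ n * C * (1 - rho ^+ k) / (1 - rho).
    by field; rewrite gt_eqF.
  by [].
have small e : 0 < e -> exists N, forall n k, (N <= n)%N ->
    cnorm (X (n + k)%N - X n) < e.
  move=> e0.
  have e1 : 0 < e * (1 - rho) / (C + 1).
    by rewrite divr_gt0 ?mulr_gt0 // ltr_wpDl.
  have : rho ^+ n @[n --> \oo] --> (0 : R)
    by apply: cvg_expr; rewrite ger0_norm.
  move=> /cvgr0Pnorm_lt /(_ _ e1) [N _ HN].
  exists N => n k Nn; apply: le_lt_trans (far n k) _.
  rewrite ltr_pdivrMr //.
  have := HN n Nn; rewrite /= ger0_norm ?exprn_ge0 // => h.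
  apply: le_lt_trans (_ : rho ^+ n * (C + 1) < _).
    by rewrite ler_wpM2l ?exprn_ge0 // lerDl.
  by rewrite -ltr_pdivlMr // ltr_wpDl.
have [l Hl] : exists l : A, forall e : R, 0 < e -> exists N : nat,
    forall n : nat, (N <= n)%N -> cnorm (X n - l) < e.
  apply: cnorm_complete => e e0; have [N HN] := small e e0.
  exists N => m n Nm Nn; case: (leqP n m) => [nm|/ltnW mn].
    by rewrite -(subnKC nm) HN.
  by rewrite cnormBC -(subnKC mn) HN.
have Kl : K l.
  apply: clK => e e0; have [N HN] := Hl e e0.
  by exists (X N) => //; rewrite cnormBC HN.
exists l => //; apply/eqP; rewrite -subr_eq0; apply/eqP.
apply: cnorm_small => e e0; have e2 : 0 < e / 2 by rewrite divr_gt0.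
have [N HN] := Hl _ e2.
apply: le_trans (cnorm_triangle (X N.+1) _ _) _.
have h1 := HN N.+1 (leqnSn N).
have h2 := FL _ _ Kl (KX N); have h3 := HN N (leqnn N).
have : rho * cnorm (l - X N) <= cnorm (l - X N).
  by rewrite ler_piMl ?cnorm_ge0 // ltW.
move: h2 h3; rewrite (cnormBC l) /= => h2 h3 h4.
move: h1; rewrite /= => h1; lra.
Qed.

End CStarBasics.

(** * Star-homomorphisms are contractive *)

Lemma subrACA (V : zmodType) (a b c d : V) :
  (a - b - (c - d) = a - c - (b - d))%R.
Proof. by rewrite !opprB addrACA [RHS]addrACA [(- b - c)%R]addrC. Qed.

Section Closed.
Local Open Scope classical_set_scope.
Local Open Scope ring_scope.
Variables (R : realType) (A : cstarAlgType R).
Implicit Types (x y z : A) (c : R[i]).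

(** Used to prove a condition closed, by writing it as the vanishing of a
    Lipschitz map. *)
Lemma norm_closed_zero (B : cstarAlgType R) (C : R) (h : A -> B) :
  (forall x y, cnorm (h x - h y) <= C * cnorm (x - y)) ->
  norm_closed [set x | h x = 0].
Proof.
move=> hL x hx; apply: cnorm_small => e e0 /=.
have C1 : 0 < `|C| + 1 by rewrite ltr_wpDl.
have [y hy xy] := hx (e / (`|C| + 1)) (divr_gt0 e0 C1).
have := hL x y; rewrite /= in hy; rewrite hy subr0 => hle.
apply: le_trans hle _; apply: le_trans (_ : (`|C| + 1) * cnorm (x - y) <= _).
  by rewrite ler_wpM2r ?cnorm_ge0 // (le_trans (ler_norm C)) // lerDl.
by rewrite mulrC -ler_pdivlMr // ltW.
Qed.

Lemma norm_closedI (M N : set A) :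
  norm_closed M -> norm_closed N -> norm_closed (M `&` N).
Proof.
by move=> cM cN x h; split; [apply: cM|apply: cN] => e e0;
  have [y [My Ny] xy] := h e e0; exists y.
Qed.

Lemma norm_closed_ball r : norm_closed [set x : A | cnorm x <= r].
Proof.
move=> x hx /=; apply/ler_addgt0Pl => e e0.
have [y /= yr xy] := hx e e0.
have := cnormD_le (x - y) y; rewrite subrK => h.
by apply: le_trans h _; rewrite lerD // ltW.
Qed.

End Closed.

Section StarHom.
Local Open Scope classical_set_scope.
Local Open Scope ring_scope.
Variables (R : realType).
Implicit Types (A B D : cstarAlgType R).

Notation normc := ComplexField.Normc.normc.

Lemma star_hom_linear A B (f : A -> B) : star_hom f -> linear f.
Proof. by case. Qed.

Lemma star_homD A B (f : A -> B) x y : star_hom f -> f (x + y) = f x + f y.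
Proof. by case=> fl _ _ _; have := fl 1 x y; rewrite !scale1r. Qed.

Lemma star_hom0 A B (f : A -> B) : star_hom f -> f 0 = 0.
Proof.
move=> fh; have := star_homD 0 0 fh; rewrite addr0 => /eqP.
by rewrite -subr_eq subrr => /eqP.
Qed.

Lemma star_homZ A B (f : A -> B) c x : star_hom f -> f (c *: x) = c *: f x.
Proof.
move=> fh; have [fl _ _ _] := fh.
by have := fl c x 0; rewrite (star_hom0 fh) !addr0.
Qed.

Lemma star_homN A B (f : A -> B) x : star_hom f -> f (- x) = - f x.
Proof. by move=> fh; rewrite -scaleN1r (star_homZ _ _ fh) scaleN1r. Qed.

Lemma star_homB A B (f : A -> B) x y : star_hom f -> f (x - y) = f x - f y.
Proof. by move=> fh; rewrite (star_homD _ _ fh) (star_homN _ fh). Qed.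

Lemma star_hom1 A B (f : A -> B) : star_hom f -> f 1 = 1. Proof. by case. Qed.
Lemma star_homM A B (f : A -> B) x y : star_hom f -> f (x * y) = f x * f y.
Proof. by case. Qed.
Lemma star_homS A B (f : A -> B) x : star_hom f -> f x^`* = (f x)^`*.
Proof. by case. Qed.

Lemma star_homX A B (f : A -> B) x n : star_hom f -> f (x ^+ n) = f x ^+ n.
Proof.
move=> fh; elim: n => [|n IH]; first by rewrite !expr0 star_hom1.
by rewrite !exprS (star_homM _ _ fh) IH.
Qed.

Lemma star_hom_zpow A B (f : A -> B) u m :
  star_hom f -> f (zpow u m) = zpow (f u) m.
Proof.
by move=> fh; case: m => n /=; rewrite star_homX // star_homS.
Qed.

Lemma star_hom_id A : star_hom (@idfun A).
Proof. by split=> // c x y. Qed.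

Lemma star_hom_comp A B D (f : A -> B) (g : D -> A) :
  star_hom f -> star_hom g -> star_hom (f \o g).
Proof.
move=> fh gh; have [fl f1 fM fS] := fh; have [gl g1 gM gS] := gh.
split=> [c x y||x y|x] /=.
- by rewrite gl fl.
- by rewrite g1.
- by rewrite gM fM.
- by rewrite gS fS.
Qed.

(** The witness is [b = sqrt (1 - a^2)].  Writing [b = 1 - c], the equation for
    [b] becomes [c = (a^2 + c^2) / 2], whose right-hand side is a contraction of
    ratio [cnorm a] on the selfadjoint elements of the ball of radius [cnorm a]
    that commute with [a]. *)
Lemma selfadjoint_unitary_part A (a : A) : a^`* = a -> cnorm a < 1 ->
  exists2 b : A, b^`* = b & (a + 'i *: b)^`* * (a + 'i *: b) = 1.
Proof.
move=> a_sa a1.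
pose rho := cnorm a; pose h : R[i] := 2^-1.
have r0 : 0 <= rho by exact: cnorm_ge0.
have hE : normc h = 2^-1 by exact: normc_natV.
have hJ : Num.conj h = h by rewrite fmorphV rmorph_nat.
pose K := [set c : A | [/\ c^`* = c, a * c = c * a & cnorm c <= rho]].
pose F (c : A) := h *: (a * a + c * c).
have clK : norm_closed K.
  have cl1 : norm_closed [set c : A | c^`* - c = 0].
    apply: (@norm_closed_zero _ _ _ 2 (fun c => c^`* - c)) => x y.
    rewrite subrACA -starB; apply: le_trans (cnormB_le _ _) _.
    by rewrite cnorm_star mulr_natl mulr2n.
  have cl2 : norm_closed [set c : A | a * c - c * a = 0].
    apply: (@norm_closed_zero _ _ _ (2 * rho) (fun c => a * c - c * a)) => x y.
    rewrite subrACA -mulrBr -mulrBl; apply: le_trans (cnormB_le _ _) _.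
    have h1 := cnormM_le a (x - y); have h2 := cnormM_le (x - y) a.
    apply: le_trans (lerD h1 h2) _.
    by rewrite -/rho; lra.
  have cl3 := @norm_closed_ball _ A rho.
  have := norm_closedI (norm_closedI cl1 cl2) cl3.
  congr norm_closed; apply/seteqP; split=> c /=.
    by move=> [[/eqP + /eqP +] c3]; rewrite !subr_eq0 => /eqP ? /eqP ?.
  by move=> [c1 c2 c3]; split=> //; rewrite c1 c2 !subrr.
have K0 : K 0 by split; rewrite ?star0 ?mulr0 ?mul0r // cnorm0.
have FK c : K c -> K (F c).
  move=> [c1 c2 c3]; split.
  - by rewrite starZ starD !starM c1 a_sa hJ.
  - by rewrite /F -scalerAr -scalerAl mulrDr mulrDl !mulrA c2 -(mulrA c a) c2 mulrA.
  - rewrite cnormZ hE.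
    have : cnorm (a * a + c * c) <= rho * 1 + rho * 1.
      apply: le_trans (cnormD_le _ _) (lerD _ _); apply: le_trans (cnormM_le _ _) _.
        by rewrite ler_wpM2l // ltW.
      by rewrite ler_pM ?cnorm_ge0 // (le_trans c3) // ltW.
    lra.
have FL x y : K x -> K y -> cnorm (F x - F y) <= rho * cnorm (x - y).
  move=> [_ _ x3] [_ _ y3]; rewrite /F -scalerBr cnormZ hE.
  have -> : a * a + x * x - (a * a + y * y) = (x - y) * x + y * (x - y).
    by rewrite opprD addrACA subrr add0r mulrBl mulrBr addrA subrK.
  have h1 := cnormD_le ((x - y) * x) (y * (x - y)).
  have h2 := cnormM_le (x - y) x; have h3 := cnormM_le y (x - y).
  have h4 : cnorm (x - y) * cnorm x <= cnorm (x - y) * rho.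
    by rewrite ler_wpM2l ?cnorm_ge0.
  have h5 : cnorm y * cnorm (x - y) <= rho * cnorm (x - y).
    by rewrite ler_wpM2r ?cnorm_ge0.
  move: h4; rewrite mulrC [_ * rho]mulrC mulrC => h4; lra.
have [c [c1 c2 c3] cE] := contraction_fixpoint clK r0 a1 K0 FK FL.
pose b := 1 - c.
have ab : a * b = b * a by rewrite mulrBr mulrBl mulr1 mul1r c2.
have bb : b * b = 1 - a * a.
  have c2E : c + c = a * a + c * c.
    rewrite -{1 2}cE /F -scalerDl /h.
    have -> : 2^-1 + 2^-1 = 1 :> R[i] by field.
    by rewrite scale1r.
  rewrite mulrBr mulrBl mulr1 mul1r mulrBl mul1r.
  have -> : a * a = c + c - c * c by rewrite c2E addrK.
  by rewrite -[LHS]addrA -opprD addrA.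
have b_sa : b^`* = b by rewrite starB star1 c1.
exists b => //.
rewrite starD starZ a_sa b_sa conjCi mulrDr !mulrDl -!scalerAl -!scalerAr.
have ii : - 'i * 'i = 1 :> R[i] by rewrite mulNr -expr2 sqrCi opprK.
rewrite !scalerA ii scale1r bb ab scaleNr.
by rewrite addrA addrNK addrC subrK.
Qed.

(** A selfadjoint [a] of norm less than one is the real part of a unitary [U], and
    [f U] is again unitary, hence of norm one.  The C*-identity reduces the general
    case to [x^* x]. *)
Lemma star_hom_contractive A B (f : A -> B) x :
  star_hom f -> cnorm (f x) <= cnorm x.
Proof.
move=> fh.
have small (a : A) : a^`* = a -> cnorm a < 1 -> cnorm (f a) <= 1.
  move=> a_sa a1; have [b b_sa] := selfadjoint_unitary_part a_sa a1.
  set U := _ + _ => Ub.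
  have fU : cnorm (f U) = 1.
    by apply: cnorm_isometry; rewrite -star_homS // -star_homM // Ub star_hom1.
  have aE : a = (2^-1 : R[i]) *: (U + U^`*).
    rewrite starD starZ a_sa b_sa conjCi scaleNr addrACA subrr addr0.
    have -> : a + a = (2 : R[i]) *: a by rewrite scaler_nat mulr2n.
    by rewrite scalerA mulVf ?scale1r // pnatr_eq0.
  rewrite aE star_homZ // star_homD // star_homS // cnormZ.
  rewrite normc_natV.
  have := cnormD_le (f U) (f U)^`*; rewrite cnorm_star fU; lra.
have sa (a : A) : a^`* = a -> cnorm (f a) <= cnorm a.
  move=> a_sa; apply/ler_addgt0Pl => e e0; rewrite addrC.
  have r0 : 0 < cnorm a + e by rewrite ltr_wpDl ?cnorm_ge0.
  pose c : R[i] := (((cnorm a + e)^-1)%:C)%C.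
  have cE : normc c = (cnorm a + e)^-1 by rewrite normc_real gtr0_norm ?invr_gt0.
  have cJ : Num.conj c = c by apply/CrealP; rewrite /c complex_real.
  have := small (c *: a); rewrite starZ cJ a_sa => /(_ erefl).
  rewrite star_homZ // !cnormZ cE => h.
  have : (cnorm a + e)^-1 * cnorm a < 1.
    by rewrite mulrC ltr_pdivrMr // mul1r ltrDl.
  by move=> /h; rewrite mulrC ler_pdivrMr // mul1r.
rewrite -(ler_pXn2r (n := 2)) ?nnegrE ?cnorm_ge0 // -!cstar_norm.
by rewrite -star_homS // -star_homM // sa // starM starK.
Qed.

Lemma star_homB_contractive A B (f : A -> B) x y :
  star_hom f -> cnorm (f x - f y) <= cnorm (x - y).
Proof. by move=> fh; rewrite -star_homB // star_hom_contractive. Qed.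

Lemma star_hom_eq_generated A B (f g : A -> B) (G : set A) :
  star_hom f -> star_hom g -> (forall x, G x -> f x = g x) ->
  forall x, cstar_generated G x -> f x = g x.
Proof.
move=> fh gh fgG x Gx; apply: (Gx [set x | f x = g x]); split=> //.
split=> /=.
- by rewrite !star_hom0.
- by move=> c y z fy fz; rewrite !(star_homD, star_homZ) // fy fz.
- by move=> y z fy fz; rewrite !star_homM // fy fz.
- by move=> y fy; rewrite !star_homS // fy.
- have cl : norm_closed [set y : A | f y - g y = 0].
    apply: (@norm_closed_zero _ _ _ 2 (fun y => f y - g y)) => y z.
    rewrite subrACA; apply: le_trans (cnormB_le _ _) _.
    by rewrite mulr_natl mulr2n lerD // star_homB_contractive.
  move=> y hy; apply/eqP; rewrite -subr_eq0; apply/eqP; apply: cl => e e0.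
  by have [z fz yz] := hy e e0; exists z => //=; rewrite fz subrr.
Qed.

End StarHom.

(** * The dense span of the terms *)

Section UnitaryPowers.
Local Open Scope ring_scope.
Variables (R : realType) (A : cstarAlgType R) (u : A).
Hypotheses (uSu : u^`* * u = 1) (uuS : u * u^`* = 1).
Implicit Types (m n : int).

Lemma zpow1 : zpow u 1 = u.
Proof. exact: expr1. Qed.

Lemma zpow_addr1 m : zpow u (m + 1) = zpow u m * u.
Proof.
case: m => n; first by rewrite -PoszD addn1 /= exprSr.
case: n => [|n]; first by rewrite /= expr1 uSu.
have -> : Negz n.+1 + 1 = Negz n by rewrite !NegzE; lia.
by rewrite /= [in RHS]exprSr -mulrA uSu mulr1.
Qed.

Lemma zpow_subr1 m : zpow u (m - 1) = zpow u m * u^`*.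
Proof. by rewrite -{2}(subrK 1 m) zpow_addr1 -mulrA uuS mulr1. Qed.

Lemma zpowD m n : zpow u (m + n) = zpow u m * zpow u n.
Proof.
elim/int_rect: n => [|n IH|n IH]; first by rewrite addr0 /= expr0 mulr1.
  by rewrite -addn1 PoszD addrA !zpow_addr1 IH mulrA.
have -> : - n.+1%:Z = - n%:Z - 1 by rewrite intS opprD addrC.
by rewrite addrA !zpow_subr1 IH mulrA.
Qed.

Lemma zpowNl m : zpow u (- m) * zpow u m = 1.
Proof. by rewrite -zpowD addNr /= expr0. Qed.

Lemma zpow_star m : (zpow u m)^`* = zpow u (- m).
Proof.
have starX (x : A) (n : nat) : (x ^+ n)^`* = x^`* ^+ n.
  elim: n => [|n IH]; first by rewrite !expr0 star1.
  by rewrite exprS starM IH exprSr.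
case: m => n; last by rewrite NegzE opprK /= starX starK.
by case: n => [|n]; rewrite ?oppr0 //= ?expr0 ?star1 // starX.
Qed.

Lemma zpow_isometry m : (zpow u m)^`* * zpow u m = 1.
Proof. by rewrite zpow_star zpowNl. Qed.

Lemma cnorm_zpow m : cnorm (zpow u m) = 1.
Proof. exact: cnorm_isometry (zpow_isometry m). Qed.

Lemma zpowC m n : zpow u m * zpow u n = zpow u n * zpow u m.
Proof. by rewrite -!zpowD addrC. Qed.

End UnitaryPowers.

(** The restrictions to [P] of the characters of the group [P^-1 P]. *)
Definition multiplicative_on (R : realType) (P : set nat) (c : nat -> R[i]) :=
  [/\ forall p, P p -> (`|c p| = 1)%R, c 1%N = 1%R &
      forall p q, P p -> P q -> c (p * q)%N = (c p * c q)%R].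

Definition combination (R : realType) (A : cstarAlgType R) (I : Type) (t : I -> A)
    (l : seq (R[i] * I)) : A := (\sum_(i <- l) i.1 *: t i.2)%R.

Definition all_in (R : realType) (I : eqType) (ok : I -> Prop) (l : seq (R[i] * I)) :=
  forall i, i \in l -> ok i.2.

Lemma all_in_cat (R : realType) (I : eqType) (ok : I -> Prop) (l l' : seq (R[i] * I)) :
  all_in ok l -> all_in ok l' -> all_in ok (l ++ l').
Proof. by move=> h h' i; rewrite mem_cat => /orP[/h|/h']. Qed.

Section Relations.
Local Open Scope classical_set_scope.
Local Open Scope ring_scope.
Variables (R : realType) (P : set nat) (A : cstarAlgType R) (u : A) (s : nat -> A).
Hypothesis rel : boundary_relations P u s.
Hypothesis P_mon : nat_submonoid P.
Hypothesis P_gt0 : forall p, P p -> (0 < p)%N.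
Implicit Types (p q r : nat) (m n : int).

Notation U := (zpow u).

Let UD m n : U (m + n) = U m * U n.
Proof. exact: zpowD (br_unitary_l rel) (br_unitary_r rel) _ _. Qed.
Let US m : (U m)^`* = U (- m). Proof. exact: zpow_star. Qed.
Let U0 : U 0 = 1. Proof. by rewrite /= expr0. Qed.

Lemma cnorm_gen p : P p -> cnorm (s p) = 1.
Proof. by move=> /(br_isometry rel); exact: cnorm_isometry. Qed.

Lemma gen_starU p m : P p -> (s p)^`* * U (p%:Z * m) = U m * (s p)^`*.
Proof.
move=> Pp; have := congr1 star (br_I rel (- m) Pp).
by rewrite !starM !US mulrN !opprK => ->.
Qed.

(** On [l^2(Z)], where [u e_k = e_(k+1)] and [s_p e_k = e_(pk)], this is the
    compression of a translation to the subspace of multiples of [p]. *)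
Lemma gen_compress p m : P p ->
  (s p)^`* * U m * s p = if (p%:Z %| m)%Z then U (m %/ p%:Z)%Z else 0.
Proof.
move=> Pp; case: ifP => [/dvdzP[k ->]|/negP pm].
  rewrite mulzK; last by rewrite -lt0n P_gt0.
  by rewrite mulrC gen_starU // -mulrA (br_isometry rel) // mulr1.
apply: (br_II0 rel) => // -[m1 [m2 mE]]; apply: pm.
by rewrite mE -mulrDr dvdz_mulr.
Qed.

Lemma gen_commute p q : P p -> P q -> s p * s q = s q * s p.
Proof. by move=> Pp Pq; rewrite !(br_mul rel) // mulnC. Qed.

Lemma gen_unfold p : P p -> \sum_(k < p) U k%:Z * s p * (s p)^`* * U (- k%:Z) = 1.
Proof. exact: (br_III rel). Qed.

(** In the representation on [l^2(Z)], the partial affine map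
    [j |-> a + (r / q) (j + b)], defined where [q] divides [j + b]. *)
Definition term (i : int * nat * nat * int) : A :=
  let: (a, r, q, b) := i in U a * s r * (s q)^`* * U b.

Definition admissible (i : int * nat * nat * int) := P i.1.1.2 /\ P i.1.2.

Local Notation comb := (@combination R A _ term).

Definition term_span : set A := [set y | exists2 l, all_in admissible l & y = comb l].

Lemma term_span0 : term_span 0.
Proof. by exists [::] => //; rewrite /combination big_nil. Qed.

Lemma term_span_linear (c : R[i]) x y :
  term_span x -> term_span y -> term_span (c *: x + y).
Proof.
move=> [l lP ->] [l' l'P ->].
exists ([seq (c * i.1, i.2) | i <- l] ++ l').
  by apply: all_in_cat => // i /mapP[j /lP jP ->].
rewrite /combination big_cat big_map scaler_sumr; congr (_ + _).
by apply: eq_bigr => i _; rewrite scalerA.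
Qed.

Lemma term_spanD x y : term_span x -> term_span y -> term_span (x + y).
Proof. by rewrite -{2}(scale1r x); exact: term_span_linear. Qed.

Lemma term_spanZ (c : R[i]) x : term_span x -> term_span (c *: x).
Proof. by rewrite -(addr0 (c *: x)) => /term_span_linear; apply; exact: term_span0. Qed.

Lemma term_span_sum (I : eqType) (l : seq I) (F : I -> A) :
  (forall i, i \in l -> term_span (F i)) -> term_span (\sum_(i <- l) F i).
Proof.
elim: l => [|i l IH] h; first by rewrite big_nil; exact: term_span0.
rewrite big_cons; apply: term_spanD; first by apply: h; rewrite mem_head.
by apply: IH => j jl; apply: h; rewrite inE jl orbT.
Qed.

Lemma term_spanT a r q b : P r -> P q -> term_span (term (a, r, q, b)).
Proof.
move=> Pr Pq; exists [:: (1, (a, r, q, b))].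
  by move=> i; rewrite inE => /eqP ->.
by rewrite /combination big_seq1 scale1r.
Qed.

(** Expanding the unit by relation (III) for [q] makes [s_q^* u^m s_r] a sum of
    terms without recourse to the least common multiples of [P]. *)
Lemma gen_starU_gen q r m : P q -> P r ->
  (s q)^`* * U m * s r = \sum_(k < q)
    ((s q)^`* * U (m + r%:Z * k%:Z) * s q) * s r * (s q)^`* * U (- k%:Z).
Proof.
move=> Pq Pr; rewrite -[in LHS](mulr1 (s r)) -(gen_unfold Pq) !mulr_sumr.
apply: eq_bigr => k _; rewrite !mulrA -[_ * s r * U k]mulrA (br_I rel) //.
by rewrite UD !mulrA -[_ * s q * s r]mulrA (gen_commute Pq Pr) !mulrA.
Qed.

Lemma term_span_termM a r q b a' r' q' b' : P r -> P q -> P r' -> P q' ->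
  term_span (term (a, r, q, b) * term (a', r', q', b')).
Proof.
move=> Pr Pq Pr' Pq'.
have -> : term (a, r, q, b) * term (a', r', q', b') =
    U a * s r * ((s q)^`* * U (b + a') * s r') * ((s q')^`* * U b').
  by rewrite /term UD !mulrA.
rewrite gen_starU_gen // mulr_sumr mulr_suml.
apply: term_span_sum => k _; rewrite gen_compress //.
case: ifP => _; last by rewrite !(mul0r, mulr0); exact: term_span0.
set e := divz _ _.
suff -> : U a * s r * (U e * s r' * (s q)^`* * U (- k%:Z)) * ((s q')^`* * U b') =
    term (a + r%:Z * e, (r * r')%N, (q' * q)%N, q'%:Z * - k%:Z + b').
  by apply: term_spanT; apply: P_mon.2.
rewrite /term !UD -!(br_mul rel) // starM !mulrA -[_ * s r * U e]mulrA.
by rewrite (br_I rel) // !mulrA -[_ * U (- k%:Z) * _]mulrA -gen_starU // !mulrA.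
Qed.

Lemma term_spanM x y : term_span x -> term_span y -> term_span (x * y).
Proof.
move=> [l lP ->] [l' l'P ->]; rewrite /combination mulr_suml.
apply: term_span_sum => -[c [[[a r] q] b]] /lP[/= Pr Pq].
rewrite mulr_sumr; apply: term_span_sum => -[c' [[[a' r'] q'] b']] /l'P[/= Pr' Pq'].
by rewrite -scalerAl -scalerAr; do 2!apply: term_spanZ; exact: term_span_termM.
Qed.

Lemma term_spanS x : term_span x -> term_span x^`*.
Proof.
move=> [l lP ->]; rewrite /combination star_sum.
apply: term_span_sum => -[c [[[a r] q] b]] /lP[/= Pr Pq].
rewrite starZ; apply: term_spanZ.
suff -> : (U a * s r * (s q)^`* * U b)^`* = term (- b, q, r, - a) by exact: term_spanT.
by rewrite /term !starM starK !US !mulrA.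
Qed.

(** The span is a *-algebra that contains the generators, so its closure is a
    C*-subalgebra. *)
Lemma term_span_dense :
  cstar_generated ([set u] `|` [set s p | p in P]) = [set: A] ->
  forall x (e : R), 0 < e -> exists2 l, all_in admissible l & cnorm (x - comb l) < e.
Proof.
move=> gen x.
have half (e : R) : 0 < e -> 0 < e / 2 by move=> e0; rewrite divr_gt0.
pose M : set A := [set x | forall e : R, 0 < e -> exists2 y, term_span y & cnorm (x - y) < e].
suff Mx : M x.
  by move=> e /Mx[y [l lP ->] xl]; exists l.
have : [set: A] x by []; rewrite -gen => /(_ M); apply.
have sub y : term_span y -> M y by move=> Ty e e0; exists y; rewrite // subrr cnorm0.
split; last first.
  have P1 : P 1%N by exact: P_mon.1.
  move=> _ [->|[p Pp <-]]; apply: sub.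
    suff -> : u = term (1, 1%N, 1%N, 0) by apply: term_spanT.
    by rewrite /term U0 (br_one rel) star1 !mulr1 zpow1.
  suff -> : s p = term (0, p, 1%N, 0) by apply: term_spanT.
  by rewrite /term U0 (br_one rel) star1 !mulr1 mul1r.
split=> /=.
- exact/sub/term_span0.
- move=> c y z My Mz e e0.
  have c0 : 0 < ComplexField.Normc.normc c + 1 by rewrite ltr_wpDl ?normc_ge0.
  have [y' Ty yy'] := My (e / 2 / (ComplexField.Normc.normc c + 1)) (divr_gt0 (half _ e0) c0).
  have [z' Tz zz'] := Mz (e / 2) (half _ e0).
  exists (c *: y' + z'); first exact: term_span_linear.
  rewrite opprD addrACA -scalerBr; apply: le_lt_trans (cnormD_le _ _) _.
  rewrite cnormZ [e]splitr ler_ltD //.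
  move/ltW: yy'; rewrite ler_pdivlMr // => h; apply: le_trans h.
  by rewrite mulrC ler_wpM2l ?cnorm_ge0 // lerDl.
- move=> y z My Mz e e0.
  have n1 : 0 < cnorm z + 1 by rewrite ltr_wpDl ?cnorm_ge0.
  have [y' Ty yy'] := My (e / 2 / (cnorm z + 1)) (divr_gt0 (half _ e0) n1).
  have n2 : 0 < cnorm y' + 1 by rewrite ltr_wpDl ?cnorm_ge0.
  have [z' Tz zz'] := Mz (e / 2 / (cnorm y' + 1)) (divr_gt0 (half _ e0) n2).
  exists (y' * z'); first exact: term_spanM.
  have -> : y * z - y' * z' = (y - y') * z + y' * (z - z').
    by rewrite mulrBl mulrBr addrA subrK.
  apply: le_lt_trans (cnormD_le _ _) _; rewrite [e]splitr.
  move: yy'; rewrite ltr_pdivlMr // => h1; move: zz'; rewrite ltr_pdivlMr // => h2.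
  apply: ler_ltD.
    apply: (le_trans (cnormM_le _ _)); apply: (le_trans _ (ltW h1)).
    by rewrite ler_wpM2l ?cnorm_ge0 // lerDl.
  apply: (le_lt_trans (cnormM_le _ _)); apply: (le_lt_trans _ h2).
  by rewrite mulrC ler_wpM2l ?cnorm_ge0 // lerDl.
- move=> y My e e0; have [z Tz yz] := My e e0.
  by exists z^`*; [exact: term_spanS | rewrite -starB cnorm_star].
- move=> y hy e e0; have e2 : 0 < e / 2 by rewrite divr_gt0.
  have [z Mz yz] := hy _ e2; have [w Tw zw] := Mz _ e2.
  exists w => //; apply: le_lt_trans (cnorm_triangle z _ _) _.
  by rewrite [e]splitr ltrD.
Qed.

(** Relation (II) survives because [p p' = q q'] forces
    [c p c p' = c q c q']. *)
Lemma boundary_relations_scale (c : nat -> R[i]) :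
  multiplicative_on P c -> boundary_relations P u (fun p => c p *: s p).
Proof.
move=> [c_unit c1 cM].
have cc p : P p -> Num.conj (c p) * c p = 1.
  by move=> /c_unit h; rewrite mulrC -normCK h expr1n.
split.
- exact: (br_unitary_l rel).
- exact: (br_unitary_r rel).
- by move=> p Pp; rewrite starZ -scalerAl -scalerAr scalerA cc // scale1r (br_isometry rel).
- by move=> p q Pp Pq; rewrite -scalerAl -scalerAr scalerA (br_mul rel) // cM.
- by rewrite c1 scale1r (br_one rel).
- by move=> p m Pp; rewrite -scalerAl -scalerAr (br_I rel).
- move=> p q p' q' m m1 m2 Pp Pq Pp' Pq' mE PP ppqq.
  rewrite !starZ -!(scalerAl, scalerAr) !scalerA.
  rewrite (br_II rel Pp Pq Pp' Pq' mE PP ppqq); congr (_ *: _).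
  have := congr1 c ppqq; rewrite !cM // => h.
  have hp := cc _ Pp; have hq' := cc _ Pq'.
  move: (Num.conj (c p)) (Num.conj (c q')) hp hq' => d d' hp hq'.
  have -> : c q * d = d * d' * (c q * c q') by rewrite -[LHS]mulr1 -hq'; ring.
  have -> : d * d' * (c q * c q') = (d * c p) * (d' * c p') by rewrite -h; ring.
  by rewrite hp mul1r.
- move=> p q m Pp Pq h.
  by rewrite starZ -!(scalerAl, scalerAr) (br_II0 rel) // !scaler0.
- move=> p Pp; rewrite -[RHS](gen_unfold Pp); apply: eq_bigr => k _.
  by rewrite starZ -!(scalerAl, scalerAr) scalerA cc // scale1r.
Qed.

End Relations.

(** * Finite Fourier sums over roots of unity *)

Section RootsOfUnity.
Local Open Scope ring_scope.

Lemma prim_root_exists (F : numClosedFieldType) (m : nat) :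
  (0 < m)%N -> exists z : F, m.-primitive_root z.
Proof.
move=> m0; have [rs] := closed_field_poly_normal ('X^m - 1 : {poly F}).
rewrite (monicP (monicXnsubC 1 m0)) scale1r => rsE.
have: has m.-primitive_root rs; last by case/hasP=> z _ ?; exists z.
apply: (has_prim_root m0).
- by apply/allP => z; rewrite -root_prod_XsubC -rsE.
- by rewrite -separable_prod_XsubC -rsE separable_Xn_sub_1 // pnatr_eq0 -lt0n.
- by rewrite -ltnS -(size_prod_XsubC rs id) -rsE size_XnsubC.
Qed.

Lemma normr_exprz (F : numFieldType) (z : F) (e : int) : `|z| = 1 -> `|z ^ e| = 1.
Proof.
move=> z1; case: e => n; first by rewrite -exprnP normrX z1 expr1n.
by rewrite NegzE -exprnN normfV normrX z1 expr1n invr1.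
Qed.

Variables (F : numClosedFieldType) (m : nat) (z : F).
Hypothesis z_prim : m.-primitive_root z.

Let m_gt0 : (0 < m)%N. Proof. exact: prim_order_gt0 z_prim. Qed.

Lemma prim_root_norm : `|z| = 1.
Proof.
apply/eqP; rewrite -(@pexpr_eq1 _ _ m) // -normrX (prim_expr_order z_prim).
by rewrite normr1.
Qed.

Lemma prim_root_neq0 : z != 0.
Proof. by rewrite -normr_eq0 prim_root_norm oner_eq0. Qed.

Lemma prim_root_exprz (e : int) : (z ^ e == 1) = (m%:Z %| e)%Z.
Proof.
rewrite dvdzE /=; case: e => n.
  by rewrite -exprnP -(prim_order_dvd z_prim).
by rewrite NegzE -exprnN abszN /= invr_eq1 -(prim_order_dvd z_prim).
Qed.

Lemma prim_root_sum (e : int) :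
  \sum_(k < m) (z ^+ k) ^ e = if (m%:Z %| e)%Z then m%:R else 0.
Proof.
have -> : \sum_(k < m) (z ^+ k) ^ e = \sum_(k < m) (z ^ e) ^+ k.
  by apply: eq_bigr => k _; rewrite !exprnP !exprz_exp mulrC.
rewrite -prim_root_exprz; case: eqP => [->|/eqP ze1].
  by rewrite (eq_bigr (fun=> 1)) ?sumr_const ?card_ord // => k _; rewrite expr1n.
apply/eqP; rewrite -(mulrI_eq0 _ (@mulfI _ (z ^ e - 1) _)) ?subr_eq0 //.
rewrite -subrX1 subr_eq0 exprnP exprz_exp mulrC -exprz_exp -exprnP.
by rewrite (prim_expr_order z_prim) exp1rz.
Qed.

End RootsOfUnity.

(** * Fejer means *)

Section LinearMaps.
Local Open Scope ring_scope.
Variables (K : pzRingType) (V W : lmodType K) (f : V -> W).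
Hypothesis f_linear : linear f.

Lemma linear_map0 : f 0 = 0.
Proof. by have := f_linear (-1) 0 0; rewrite scaler0 addr0 scaleN1r addNr. Qed.

Lemma linear_sum_map (J : Type) (l : seq J) (F : J -> V) :
  f (\sum_(i <- l) F i) = \sum_(i <- l) f (F i).
Proof.
apply: (big_morph f) => [x y|]; last exact: linear_map0.
by have := f_linear 1 x y; rewrite !scale1r.
Qed.

Lemma linear_scale_map c x : f (c *: x) = c *: f x.
Proof. by have := f_linear c x 0; rewrite linear_map0 !addr0. Qed.

Lemma linear_sub_map x y : f (x - y) = f x - f y.
Proof. by rewrite [x - y]addrC -scaleN1r f_linear scaleN1r addrC. Qed.

End LinearMaps.

(** The setting for the Fourier analysis: circle actions [g j], with the [t i] as
    joint eigenvectors, of weight [d i j] under [g j].  Integrals over a circle are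
    replaced by finite averages over the [m]-th roots of unity, with [m] larger
    than all the weights in sight. *)
Section Fejer.
Local Open Scope classical_set_scope.
Local Open Scope ring_scope.
Variables (R : realType) (A : cstarAlgType R) (I : eqType).
Variables (g : nat -> R[i] -> A -> A) (t : I -> A) (d : I -> nat -> int).
Variables (ok : I -> Prop) (X : set A).

Notation normc := ComplexField.Normc.normc.

Local Notation lincomb := (@combination R A I t).
Local Notation all_ok := (@all_in R I ok).

Hypothesis g_linear : forall j w, `|w| = 1 -> linear (g j w).
Hypothesis g_contr : forall j w x, `|w| = 1 -> cnorm (g j w x) <= cnorm x.
Hypothesis g_weight : forall j w i, `|w| = 1 -> ok i -> g j w (t i) = w ^ (d i j) *: t i.
Hypothesis X_linear : forall c x y, X x -> X y -> X (c *: x + y).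
Hypothesis X_stable : forall j w x, `|w| = 1 -> X x -> X (g j w x).

Section Component.
Variables (m : nat) (z : R[i]).
Hypothesis z_prim : m.-primitive_root z.
Implicit Types (j k : nat) (e : int) (x y : A).

Let m_gt0 : (0 < m)%N. Proof. exact: prim_order_gt0 z_prim. Qed.
Let zk_norm k : `|z ^+ k| = 1.
Proof. by rewrite normrX (prim_root_norm z_prim) expr1n. Qed.

(** The component of weight [e] modulo [m] for the action [g j]. *)
Definition component j e x : A :=
  (m%:R^-1 : R[i]) *: \sum_(k < m) (z ^+ k) ^ (- e) *: g j (z ^+ k) x.

Lemma component_linear j e : linear (component j e).
Proof.
move=> c x y; rewrite /component scalerA mulrC -scalerA -scalerDr; congr (_ *: _).
rewrite scaler_sumr -big_split; apply: eq_bigr => k _ /=.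
by rewrite (g_linear j (zk_norm k)) scalerDr !scalerA mulrC.
Qed.

Lemma component_weight j e i : ok i ->
  component j e (t i) = (if (m%:Z %| d i j - e)%Z then 1 else 0) *: t i.
Proof.
move=> oki; rewrite /component.
have -> : \sum_(k < m) (z ^+ k) ^ (- e) *: g j (z ^+ k) (t i) =
    (\sum_(k < m) (z ^+ k) ^ (d i j - e)) *: t i.
  rewrite scaler_suml; apply: eq_bigr => k _; rewrite g_weight // scalerA.
  by rewrite -expfzDr ?expf_neq0 ?(prim_root_neq0 z_prim) // addrC.
rewrite (prim_root_sum z_prim) scalerA; case: ifP => _; last by rewrite mulr0.
by rewrite mulVf // pnatr_eq0 -lt0n.
Qed.

Lemma X_sum (J : Type) (l : seq J) (F : J -> A) x :
  X x -> (forall i, X (F i)) -> X (\sum_(i <- l) F i).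
Proof.
move=> Xx XF; elim/big_rec: _ => [|i y _ Xy].
  by rewrite -(addNr x) -scaleN1r; apply: X_linear.
by rewrite -(scale1r (F i)); apply: X_linear.
Qed.

Lemma X_Z c x : X x -> X (c *: x).
Proof.
move=> Xx; rewrite -[c *: x]addr0; apply: X_linear => //.
by rewrite -(addNr x) -scaleN1r; apply: X_linear.
Qed.

Lemma X_component j e x : X x -> X (component j e x).
Proof.
move=> Xx; apply/X_Z/(X_sum _ Xx) => k; apply/X_Z/X_stable => //.
Qed.

Lemma component_norm j e x : cnorm (component j e x) <= cnorm x.
Proof.
rewrite /component cnormZ.
rewrite normc_natV.
rewrite mulrC ler_pdivrMr ?ltr0n //; apply: le_trans (cnorm_sum _ _ _) _.
apply: le_trans (_ : \sum_(k < m) cnorm x <= _).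
  apply: ler_sum => k _; rewrite cnormZ normc_unit ?mul1r ?g_contr //.
  exact: normr_exprz.
by rewrite sumr_const card_ord mulr_natr.
Qed.

(** The component of weight [e] enters with coefficient [1 - |e| / N] if
    [|e| < N], and does not occur otherwise.  Writing the coefficient as the
    proportion of pairs [(a, b)] with [a - b = e] shows that the kernel is
    [|sum_a w^a|^2 / N], whence the bound [fejer_norm]. *)
Definition fejer j N x : A := (N%:R^-1 : R[i]) *:
  \sum_(a < N) \sum_(b < N) component j (a%:Z - b%:Z) x.

Lemma fejer_linear j N : linear (fejer j N).
Proof.
move=> c x y; rewrite /fejer scalerA mulrC -scalerA -scalerDr; congr (_ *: _).
rewrite scaler_sumr -big_split; apply: eq_bigr => a _ /=.
rewrite scaler_sumr -big_split; apply: eq_bigr => b _ /=.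
exact: component_linear.
Qed.

Lemma window_dvd N (a b : nat) : (N <= m)%N -> (a < N)%N -> (b < N)%N ->
  (m%:Z %| a%:Z - b%:Z)%Z = (a == b).
Proof.
move=> Nm aN bN; apply/idP/eqP => [|->]; last by rewrite subrr dvdz0.
rewrite dvdzE /= => h; apply/eqP/contraT => ab.
have /dvdn_leq := h; lia.
Qed.

(** The Fejer kernel is nonnegative, with mean one once [N <= m]. *)
Lemma fejer_norm j N x : (0 < N)%N -> (N <= m)%N -> cnorm (fejer j N x) <= cnorm x.
Proof.
move=> N0 Nm.
pose K k : R[i] := (N%:R * m%:R)^-1 * `|\sum_(a < N) (z ^+ k) ^+ a| ^+ 2.
have NV_ge0 : 0 <= (N%:R * m%:R)^-1 :> R[i] by rewrite invr_ge0 mulr_ge0 ?ler0n.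
have KE k : K k = (N%:R * m%:R)^-1 * \sum_(a < N) \sum_(b < N) (z ^+ k) ^ (- (a%:Z - b%:Z)).
  congr (_ * _); rewrite normCK mulrC rmorph_sum mulr_suml.
  apply: eq_bigr => a _; rewrite mulr_sumr; apply: eq_bigr => b _.
  rewrite opprB addrC expfzDr ?expf_neq0 ?(prim_root_neq0 z_prim) //.
  congr (_ * _); rewrite -exprnN rmorphXn -exprVn; congr (_ ^+ _).
  by rewrite [RHS]invC_norm zk_norm expr1n invr1 mul1r.
have sumK : \sum_(k < m) K k = 1.
  under eq_bigr do rewrite KE.
  rewrite -mulr_sumr exchange_big /=.
  have -> : \sum_(a < N) \sum_(k < m) \sum_(b < N) (z ^+ k) ^ (- (a%:Z - b%:Z)) =
      \sum_(a < N) (m%:R : R[i]).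
    apply: eq_bigr => a _; rewrite exchange_big /=.
    rewrite (bigD1 a) //= (prim_root_sum z_prim) subrr oppr0 dvdz0.
    rewrite [X in _ + X]big1 ?addr0 // => b ba.
    rewrite (prim_root_sum z_prim) opprB (window_dvd Nm (ltn_ord b) (ltn_ord a)).
    by rewrite val_eqE (negbTE ba).
  rewrite sumr_const card_ord -[m%:R *+ N]mulr_natl mulVf //.
  by rewrite mulf_neq0 // pnatr_eq0 -lt0n.
have -> : fejer j N x = \sum_(k < m) K k *: g j (z ^+ k) x.
  under [RHS]eq_bigr => k _ do rewrite KE invfM -mulrA mulr_sumr -scalerA scaler_suml.
  rewrite -scaler_sumr exchange_big /=; congr (_ *: _); apply: eq_bigr => a _.
  under [RHS]eq_bigr => k _ do rewrite mulr_sumr scaler_suml.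
  rewrite exchange_big /=; apply: eq_bigr => b _; rewrite /component scaler_sumr.
  by apply: eq_bigr => k _; rewrite scalerA.
apply: le_trans (cnorm_sum _ _ _) _.
apply: le_trans (_ : \sum_(k < m) normc (K k) * cnorm x <= _).
  by apply: ler_sum => k _; rewrite cnormZ ler_wpM2l ?normc_ge0 ?g_contr.
rewrite -mulr_suml; suff -> : \sum_(k < m) normc (K k) = 1 by rewrite mul1r.
suff : ((\sum_(k < m) normc (K k))%:C)%C = 1 :> R[i] by case.
rewrite -sumK rmorph_sum; apply: eq_bigr => k _.
rewrite -[LHS]/(`|K k|) ger0_norm // mulr_ge0 // exprn_ge0 //.
Qed.

Lemma sum_lt_le N k : (\sum_(a < N) (a < k) <= k)%N.
Proof.
suff : (\sum_(a < N) (a < k) <= minn N k)%N by move=> h; apply: leq_trans h (geq_minr _ _).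
elim: N => [|N IH]; rewrite ?big_ord0 // big_ord_recr /=.
by move: (\sum_(i < N) _)%N IH => S; case: (ltnP N k) => /=; lia.
Qed.

Lemma sum_ge_le N k : (\sum_(a < N) (N <= a + k) <= k)%N.
Proof.
rewrite (reindex_inj rev_ord_inj) /=; apply: leq_trans (sum_lt_le N k).
by apply: leq_sum => a _; have := ltn_ord a; case: leqP; case: ltnP => //=; lia.
Qed.

(** For each [a < N] there is exactly one [b < N] with [a - b = d i j] modulo [m],
    except for at most [2 |d i j|] values of [a] near the ends of the window,
    for which there is at most one. *)
Lemma fejer_weight j N i : (0 < N)%N -> (N <= m)%N -> ok i ->
  cnorm (fejer j N (t i) - t i) <= (2 * `|d i j|)%N%:R / N%:R * cnorm (t i).
Proof.
move=> N0 Nm oki; set e := d i j.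
pose n (a : nat) : nat := (\sum_(b < N) (m%:Z %| (e - (a%:Z - b%:Z))%R)%Z)%N.
pose far (a : 'I_N) : nat := ((a < `|e|) + (N <= a + `|e|))%N.
have nE (a : 'I_N) : normc ((n a)%:R - 1 : R[i]) <= (far a)%:R.
  (* [n a] counts the [b] that pair with [a]; there is one at most, as [N <= m] *)
  have n1 b0 : (b0 < N)%N -> (m%:Z %| e - (a%:Z - b0%:Z))%Z -> n a = 1%N.
    move=> b0N h; rewrite /n (bigD1 (Ordinal b0N)) //= h big1 // => b bb0.
    case h' : (_ %| _)%Z => //.
    have := rpredB h' h; have -> : e - (a%:Z - b%:Z) - (e - (a%:Z - b0%:Z)) = b%:Z - b0%:Z by ring.
    by rewrite (window_dvd Nm) // => /eqP bE; case/eqP: bb0; apply: val_inj.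
  have [n0|[b hb]] : n a = 0%N \/ exists b : 'I_N, (m%:Z %| e - (a%:Z - b%:Z))%Z.
    case: (pselect (exists b : 'I_N, (m%:Z %| e - (a%:Z - b%:Z))%Z)); first by right.
    move=> h; left; rewrite /n big1 // => b _; case h' : (_ %| _)%Z => //.
    by case: h; exists b.
  - rewrite n0 sub0r normc_unit ?normrN1 // ler1n /far.
    case: (ltnP a `|e|) => // h1; case: (leqP N (a + `|e|)) => // h2.
    have /n1 : (`|(a%:Z - e)%R| < N)%N.
      by move: (e) (nat_of_ord a) h1 h2 => e' a'; lia.
    rewrite n0 => n01.
    suff /n01 : (m%:Z %| e - (a%:Z - `|(a%:Z - e)%R|%N%:Z))%Z by [].
    have -> // : e - (a%:Z - `|(a%:Z - e)%R|%N%:Z) = 0.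
      by move: (e) (nat_of_ord a) h1 h2 => e' a'; lia.
  - rewrite (n1 b) ?ltn_ord // subrr ComplexField.Normc.normc0 ler0n //.
have -> : fejer j N (t i) = (N%:R^-1 * \sum_(a < N) (n a)%:R) *: t i.
  rewrite /fejer -scalerA scaler_suml; congr (_ *: _); apply: eq_bigr => a _.
  rewrite natr_sum scaler_suml; apply: eq_bigr => b _; rewrite component_weight //.
  by case: ifP.
have -> : (N%:R^-1 * \sum_(a < N) (n a)%:R) *: t i - t i =
    (N%:R^-1 * \sum_(a < N) ((n a)%:R - 1)) *: t i.
  rewrite sumrB sumr_const card_ord mulrBr mulVf ?pnatr_eq0 -?lt0n //.
  by rewrite scalerBl scale1r.
rewrite cnormZ ler_wpM2r ?cnorm_ge0 // ComplexField.Normc.normcM normc_natV.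
rewrite mulrC ler_wpM2r ?invr_ge0 ?ler0n //.
have normc_sum (F : 'I_N -> R[i]) : normc (\sum_a F a) <= \sum_a normc (F a).
  elim/big_ind2: _ => [|x1 x2 y1 y2 h1 h2|//]; first by rewrite ComplexField.Normc.normc0.
  exact: le_trans (le_normcD _ _) (lerD h1 h2).
apply: le_trans (normc_sum _) _; apply: le_trans (ler_sum _ (fun a _ => nE a)) _.
rewrite -natr_sum ler_nat /far big_split /= mul2n -addnn.
by apply: leq_add; [exact: sum_lt_le | exact: sum_ge_le].
Qed.

(** The Fejer means for the actions [g 0], ..., [g B.-1], of widths [N 0], ...,
    [N B.-1].  Width one extracts the component of weight zero. *)
Fixpoint fejer_iter (N : nat -> nat) (B : nat) (x : A) : A :=
  if B is B'.+1 then fejer_iter N B' (fejer B' (N B') x) else x.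

Lemma fejer_iter_linear N B : linear (fejer_iter N B).
Proof. by elim: B => //= B IH c x y; rewrite fejer_linear IH. Qed.

Lemma fejer_iter_norm N B x : (forall j, (0 < N j <= m)%N) ->
  cnorm (fejer_iter N B x) <= cnorm x.
Proof.
move=> hN; elim: B x => //= B IH x; apply: le_trans (IH _) _.
by have /andP[? ?] := hN B; apply: fejer_norm.
Qed.

Lemma component_lincomb j e l : all_ok l ->
  component j e (lincomb l) = lincomb [seq i <- l | (m%:Z %| d i.2 j - e)%Z].
Proof.
move=> okl; rewrite /combination (linear_sum_map (component_linear _ _) _ _).
rewrite big_filter [RHS]big_mkcond; apply: eq_big_seq => i /okl oki.
rewrite (linear_scale_map (component_linear _ _) _ _).
by rewrite component_weight //; case: ifP; rewrite ?scale1r // scale0r scaler0.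
Qed.

Hypothesis X_homogeneous : forall x l, X x -> all_ok l ->
  (forall i i', i \in l -> i' \in l -> d i.2 =1 d i'.2) ->
  cnorm x <= 2 * cnorm (x - lincomb l).

(** The mean expands into [(N 0)^2 ... (N B.-1)^2] components divided by
    [N 0 ... N B.-1].  Each component is an element of [X] that is as close as
    [x] to a homogeneous combination, the corresponding part of [lincomb l], so
    that its norm is at most [2 * eta].  The factor in front does not depend on
    [l]. *)
Lemma fejer_iter_small N B x l eta : (forall j, (0 < N j)%N) ->
  X x -> all_ok l -> (forall i j, i \in l -> (2 * `|d i.2 j| < m)%N) ->
  cnorm (x - lincomb l) <= eta ->
  (forall i i' j, i \in l -> i' \in l -> (B <= j)%N -> d i.2 j = d i'.2 j) ->
  cnorm (fejer_iter N B x) <= (\prod_(j < B) N j)%N%:R * (2 * eta).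
Proof.
move=> hN; elim: B x l => [|B IH] x l Xx okl lm xl hl.
  rewrite big_ord0 mul1r /=; apply: le_trans (X_homogeneous Xx okl _) _; last lra.
  by move=> i i' il i'l j; apply: hl.
have bound e : cnorm (fejer_iter N B (component B e x)) <=
    (\prod_(j < B) N j)%N%:R * (2 * eta).
  pose l' := [seq i <- l | (m%:Z %| d i.2 B - e)%Z].
  have l'l i : i \in l' -> i \in l /\ (m%:Z %| d i.2 B - e)%Z.
    by rewrite mem_filter => /andP[].
  apply: (IH _ l'); first exact: X_component.
  - by move=> i /l'l[/okl].
  - by move=> i j /l'l[/lm].
  - rewrite -component_lincomb // -(linear_sub_map (component_linear _ _) _ _).
    exact: le_trans (component_norm _ _ _) xl.
  - move=> i i' j /l'l[il ie] /l'l[i'l i'e].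
    rewrite leq_eqVlt => /predU1P[<-|Bj]; last exact: hl.
    have := rpredB ie i'e; have -> : d i.2 B - e - (d i'.2 B - e) = d i.2 B - d i'.2 B by ring.
    have := lm _ B il; have := lm _ B i'l.
    move: (d i.2 B) (d i'.2 B) => a b am bm; rewrite dvdzE /= => h.
    by apply/eqP/contraT => ab; have /dvdn_leq := h; lia.
rewrite /= /fejer (linear_scale_map (fejer_iter_linear _ _) _ _).
rewrite (linear_sum_map (fejer_iter_linear _ _) _ _).
under [X in cnorm (_ *: X)]eq_bigr => a _ do rewrite (linear_sum_map (fejer_iter_linear _ _) _ _).
rewrite cnormZ normc_natV.
rewrite mulrC ler_pdivrMr ?ltr0n // big_ord_recr /=.
apply: le_trans (cnorm_sum _ _ _) _.
apply: le_trans (_ : \sum_(a < N B) \sum_(b < N B) (\prod_(j < B) N j)%N%:R * (2 * eta) <= _).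
  apply: ler_sum => a _; apply: le_trans (cnorm_sum _ _ _) _.
  by apply: ler_sum => b _; exact: bound.
have sq (y : R) n : y *+ n *+ n = y * n%:R * n%:R by rewrite -[LHS]mulr_natr -[y *+ n]mulr_natr.
rewrite !sumr_const !card_ord natrM sq.
by rewrite (mulrAC (\prod_(j < B) N j)%N%:R).
Qed.

Lemma fejer_iter_weight N B i : (forall j, (0 < N j <= m)%N) -> ok i ->
  cnorm (fejer_iter N B (t i) - t i) <=
  (\sum_(j < B) (2 * `|d i j|)%N%:R / (N j)%:R) * cnorm (t i).
Proof.
move=> hN oki; elim: B => [|B IH].
  by rewrite big_ord0 mul0r subrr cnorm0.
rewrite big_ord_recr mulrDl /=.
apply: le_trans (cnorm_triangle (fejer_iter N B (t i)) _ _) _.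
rewrite addrC; apply: lerD => //; rewrite -(linear_sub_map (fejer_iter_linear _ _) _ _).
have /andP[? ?] := hN B.
by apply: le_trans (fejer_iter_norm _ _ hN) _; apply: fejer_weight.
Qed.

End Component.

Hypothesis d_support : forall i, ok i -> exists J, forall j,
  (`|d i j| <= J)%N /\ ((J <= j)%N -> d i j = 0).
Hypothesis dense : forall x (e : R), X x -> 0 < e ->
  exists2 l, all_ok l & cnorm (x - lincomb l) <= e.
Hypothesis X_homogeneous : forall x l, X x -> all_ok l ->
  (forall i i', i \in l -> i' \in l -> d i.2 =1 d i'.2) ->
  cnorm x <= 2 * cnorm (x - lincomb l).

Lemma support_bound l : all_ok l -> exists J, forall i j, i \in l ->
  (`|d i.2 j| <= J)%N /\ ((J <= j)%N -> d i.2 j = 0).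
Proof.
elim: l => [|i l IH] okl; first by exists 0%N.
have [|J HJ] := IH; first by move=> k kl; apply: okl; rewrite inE kl orbT.
have [J' HJ'] := d_support (okl i (mem_head _ _)).
exists (maxn J J') => k j; rewrite inE => /predU1P[->|kl].
  by have [h1 h2] := HJ' j; split=> [|h]; [lia | apply: h2; lia].
by have [h1 h2] := HJ k j kl; split=> [|h]; [lia | apply: h2; lia].
Qed.

(** The widths are [N] for the actions under which [l] has a nonzero weight, and
    one for the others, which fix [lincomb l].  The constant [C] does not depend
    on the number [B] of actions. *)
Lemma fejer_iter_approx l J : all_ok l ->
  (forall i j, i \in l -> (J <= j)%N -> d i.2 j = 0) ->
  exists C : R, forall m z (z_prim : m.-primitive_root z) N B,
    (0 < N <= m)%N -> (J <= B)%N ->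
    cnorm (fejer_iter m z (fun j => if (j < J)%N then N else 1%N) B (lincomb l)
           - lincomb l) <= C / N%:R.
Proof.
move=> okl hJ.
pose C := \sum_(i <- l) normc i.1 * ((\sum_(j < J) (2 * `|d i.2 j|)%N%:R) * cnorm (t i.2)).
exists C => m z z_prim N B /andP[N0 Nm] JB; set Nf := fun j => _.
have hNf j : (0 < Nf j <= m)%N.
  by rewrite /Nf; case: ifP => _; rewrite ?N0 //= (leq_trans N0).
rewrite /combination (linear_sum_map (fejer_iter_linear z_prim _ _) _ _).
rewrite -sumrB; apply: le_trans (cnorm_sum _ _ _) _.
rewrite /C mulr_suml big_seq [leRHS]big_seq; apply: ler_sum => i il.
rewrite (linear_scale_map (fejer_iter_linear z_prim _ _) _ _).
rewrite -scalerBr cnormZ -mulrA ler_wpM2l ?normc_ge0 //.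
apply: le_trans (fejer_iter_weight z_prim B hNf (okl i il)) _.
rewrite mulrAC ler_wpM2r ?cnorm_ge0 // mulr_suml.
rewrite -(big_mkord xpredT (fun j => (2 * `|d i.2 j|)%N%:R / (Nf j)%:R)).
rewrite (big_cat_nat_idem _ _ JB) //= ?addr0 //.
rewrite [X in _ + X]big_nat_cond [X in _ + X]big1 ?addr0; last first.
  by move=> j /andP[/andP[Jj _] _]; rewrite hJ // muln0 mul0r.
by rewrite big_mkord; apply: ler_sum => j _; rewrite /Nf ltn_ord.
Qed.

(** A first combination [l] close to [x] determines the actions to be averaged
    and the width [N]; the mean of [x] is then close to [x].  A second one, [l'],
    approximates [x] so well that [fejer_iter_small] makes this mean small, in
    spite of the factor [M = N ^ J]. *)
Theorem stable_subspace_zero x : X x -> x = 0.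
Proof.
move=> Xx; apply: cnorm_small => e e0.
have e5 : 0 < e / 5 by rewrite divr_gt0.
have [l okl xl] := dense Xx e5.
have [J HJ] := support_bound okl.
have [|C HC] := @fejer_iter_approx l J okl.
  by move=> i j il; have [] := HJ i j il.
have [N N0 CN] : exists2 N : nat, (0 < N)%N & C / N%:R <= e / 5.
  exists (Num.truncn (C / (e / 5))).+1 => //.
  rewrite ler_pdivrMr ?ltr0n // mulrC -ler_pdivrMr //.
  exact/ltW/truncnS_gt.
pose M := (N ^ J)%N.
have M0 : 0 < M%:R :> R by rewrite ltr0n expn_gt0 N0.
have [l' okl' xl'] := dense Xx (divr_gt0 e5 M0).
have [J' HJ'] := support_bound okl'.
pose B := maxn J J'; pose m := (N + 2 * J').+1.
have m0 : (0 < m)%N by [].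
have [z z_prim] := prim_root_exists R[i] m0.
pose Nf j := if (j < J)%N then N else 1%N.
have hNf j : (0 < Nf j <= m)%N by rewrite /Nf /m; case: ifP => _; lia.
have prodNf : (\prod_(j < B) Nf j = M)%N.
  rewrite -(big_mkord xpredT Nf) (big_cat_nat_idem _ _ (leq_maxl J J')) //= ?muln1 //.
  rewrite [X in (_ * X)%N]big_nat_cond [X in (_ * X)%N]big1 ?muln1; last first.
    by move=> j /andP[/andP[Jj _] _]; rewrite /Nf ltnNge Jj.
  rewrite big_mkord (eq_bigr (fun=> N)); first by rewrite prod_nat_const card_ord.
  by move=> j _; rewrite /Nf ltn_ord.
have h1 : cnorm (fejer_iter m z Nf B x) <= M%:R * (2 * (e / 5 / M%:R)).
  rewrite -[X in X%:R * _]prodNf; apply: (fejer_iter_small z_prim X_homogeneous _ Xx okl' _ xl').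
  - by move=> j; have /andP[] := hNf j.
  - by move=> i j il; have [+ _] := HJ' i j il; rewrite /m; lia.
  - move=> i i' j il i'l Bj; have J'j : (J' <= j)%N by rewrite (leq_trans _ Bj) // leq_maxr.
    by rewrite (HJ' i j il).2 // (HJ' i' j i'l).2.
have h2 := HC m z z_prim N B.
have h3 : cnorm (fejer_iter m z Nf B x - fejer_iter m z Nf B (lincomb l)) <= e / 5.
  rewrite -(linear_sub_map (fejer_iter_linear z_prim _ _) _ _).
  exact: le_trans (fejer_iter_norm z_prim _ _ hNf) xl.
have hN : (0 < N <= m)%N by rewrite N0 /m; lia.
have := h2 hN (leq_maxl J J'); rewrite -/Nf -/B => {}h2.
have {}h1 : cnorm (fejer_iter m z Nf B x) <= 2 * (e / 5).
  have ME (y w : R) : 0 < w -> w * (2 * (y / w)) = 2 * y.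
    by move=> w0; rewrite mulrCA (mulrC w) divfK ?gt_eqF.
  by rewrite ME in h1.
have h4 := cnormD_le (x - fejer_iter m z Nf B x) (fejer_iter m z Nf B x).
have h5 := cnorm_triangle (lincomb l) x (fejer_iter m z Nf B x).
have h6 := cnorm_triangle (fejer_iter m z Nf B (lincomb l)) (lincomb l) (fejer_iter m z Nf B x).
move: h2 h4 h5 h6; rewrite subrK (cnormBC (lincomb l) (fejer_iter _ _ _ _ _)).
rewrite (cnormBC (fejer_iter m z Nf B (lincomb l)) (fejer_iter m z Nf B x)).
rewrite ?(cnormBC (fejer_iter m z Nf B (lincomb l)) (lincomb l)) => h2 h4 h5 h6.
lra.
Qed.
End Fejer.

(** * Endomorphisms that fix the isometries [u^k s_p] *)

Section Rigidity.
Local Open Scope classical_set_scope.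
Local Open Scope ring_scope.
Variables (R : realType) (P : set nat) (A : cstarAlgType R) (u : A) (s : nat -> A).
Hypothesis QP : boundary_quotient P u s.
Hypothesis P_mon : nat_submonoid P.
Hypothesis P_gt0 : forall p, P p -> (0 < p)%N.

Notation U := (zpow u).
Notation normc := ComplexField.Normc.normc.

Let rel : boundary_relations P u s := bq_relations QP.
Let uSu := br_unitary_l rel.
Let uuS := br_unitary_r rel.
Let UD m n : U (m + n) = U m * U n. Proof. exact: zpowD. Qed.

Lemma gauge_hom_exists (c : nat -> R[i]) : multiplicative_on P c ->
  exists f : A -> A, [/\ star_hom f, f u = u & forall p, P p -> f (s p) = c p *: s p].
Proof.
move=> cP; have rel' := boundary_relations_scale rel cP.
by have [f [fh fu fs _]] := bq_universal QP rel'; exists f.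
Qed.

Lemma star_hom_ext (B : cstarAlgType R) (f g : A -> B) : star_hom f -> star_hom g ->
  f u = g u -> (forall p, P p -> f (s p) = g (s p)) -> f = g.
Proof.
move=> fh gh fgu fgs; apply/funext => x.
apply: (star_hom_eq_generated fh gh (G := [set u] `|` [set s p | p in P])).
  by move=> _ [->|[p Pp <-]] //; apply: fgs.
by rewrite (bq_generated QP).
Qed.

Lemma gauge_term (c : nat -> R[i]) (f : A -> A) a r q b :
  star_hom f -> f u = u -> (forall p, P p -> f (s p) = c p *: s p) -> P r -> P q ->
  f (term u s (a, r, q, b)) = (c r * Num.conj (c q)) *: term u s (a, r, q, b).
Proof.
move=> fh fu fs Pr Pq; rewrite /term !(star_homM _ _ fh) (star_homS _ fh) !(star_hom_zpow _ _ fh) fu.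
rewrite !fs // starZ -!(scalerAl, scalerAr) scalerA; congr (_ *: _).
by rewrite mulrC.
Qed.

Lemma valuation_multiplicative (j : nat) (w : R[i]) : `|w| = 1 ->
  multiplicative_on P (fun r => w ^+ logn j r).
Proof.
move=> w1; split=> [p _||p q Pp Pq]; first by rewrite normrX w1 expr1n.
  by rewrite logn1.
by rewrite lognM ?P_gt0 // exprD.
Qed.

(** The weight of a term under [s_r |-> w^(logn j r) s_r].  All weights together
    determine the fraction [r / q]; non-prime [j] contribute nothing. *)
Definition weight (i : int * nat * nat * int) (j : nat) : int :=
  (logn j i.1.1.2)%:Z - (logn j i.1.2)%:Z.

Lemma term_zpow i (k : int) : P i.1.1.2 -> P i.1.2 ->
  term u s i * U (i.1.2%:Z * k) = U (i.1.1.2%:Z * k) * term u s i.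
Proof.
case: i => [[[a r] q] b] /= Pr Pq; rewrite -mulrA -UD addrC UD !mulrA.
rewrite -[_ * (s q)^`* * _]mulrA (gen_starU rel) // !mulrA.
by rewrite -[_ * s r * _]mulrA (br_I rel) // !mulrA -!UD addrC.
Qed.

Lemma weight_eq i i' : P i.1.1.2 -> P i.1.2 -> P i'.1.1.2 -> P i'.1.2 ->
  weight i =1 weight i' -> (i.1.1.2 * i'.1.2 = i'.1.1.2 * i.1.2)%N.
Proof.
move=> h1 h2 h3 h4 ww; apply: eqn_from_log; rewrite ?muln_gt0 ?P_gt0 // => j.
rewrite !lognM ?P_gt0 //; have := ww j; rewrite /weight.
by move: (logn j _) (logn j _) (logn j _) (logn j _) => x1 x2 x3 x4; lia.
Qed.

Lemma fraction_cross_mul r0 q0 r q b a N : (b * q0 = N -> a * q = N -> r0 * q = r * q0 ->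
  0 < q0 -> 0 < q -> r0 * b = r * a)%N.
Proof.
move=> h1 h2 h3 hq0 hq; apply/eqP.
rewrite -(eqn_pmul2r hq0) -(eqn_pmul2r hq) -(mulnA r0) h1 -h2; apply/eqP.
by rewrite (mulnC a) mulnA h3; lia.
Qed.

Section Defect.
Variable p : nat.
Hypotheses (Pp : P p) (p1 : (1 < p)%N).

(** The multiples of the projection onto [e_0], in terms of [l^2(Z)]. *)
Definition defect : set A := [set x | x * s p = s p * x /\
  forall k : nat, (0 < k < p)%N -> x * U k%:Z * s p = 0].

(** Removing the factors [p] of [M] one at a time by [x s_p = s_p x], one reaches
    a digit of [M] in base [p] that is not zero. *)
Lemma defect_zpow_gen x (n M : nat) : defect x -> (0 < M < p ^ n)%N ->
  x * U M%:Z * s p ^+ n = 0.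
Proof.
move=> [xs xU]; elim: n M => [|n IH] M; first by rewrite expn0; lia.
rewrite expnS => /andP[M0 Mp]; rewrite exprS.
have UE : U M%:Z = U (M %% p)%:Z * U (p%:Z * (M %/ p)%:Z).
  by rewrite -UD; congr (zpow u _); rewrite -PoszM -PoszD addnC mulnC -divn_eq.
rewrite UE !mulrA -[_ * U (p%:Z * _) * s p]mulrA -(br_I rel) // !mulrA.
have [k0|k0] := posnP (M %% p)%N; last first.
  by rewrite xU ?mul0r // k0 ltn_pmod // ltnW.
rewrite k0 mulr1 xs -!mulrA [x * _]mulrA IH ?mulr0 //.
have p0 : (0 < p)%N by exact: P_gt0.
rewrite ltn_divLR // mulnC Mp andbT divn_gt0 //.
by apply: dvdn_leq => //; rewrite /dvdn k0.
Qed.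

(** Let [y] be the combination.  With [M] a common multiple of the denominators,
    [y u^M = u^e y], where [e / M] is the common value of the fractions [r / q]. *)
Lemma defect_homogeneous x l : defect x -> all_in (admissible P) l ->
  (forall i i', i \in l -> i' \in l -> weight i.2 =1 weight i'.2) ->
  cnorm x <= 2 * cnorm (x - combination (term u s) l).
Proof.
move=> Xx lP lw; have [xs _] := Xx.
have [->|[i0 i0l]] : l = [::] \/ exists i, i \in l.
    by case: (l) => [|i l']; [left | right; exists i; rewrite mem_head].
  rewrite /combination big_nil subr0 mulr_natl mulr2n lerDl; exact: cnorm_ge0.
set y := combination (term u s) l; pose M := (\prod_(i <- l) i.2.1.2)%N.
have M0 : (0 < M)%N.
  by rewrite /M big_seq; elim/big_ind: _ => [//|a b|i /lP[_ /P_gt0]] //; rewrite muln_gt0 => -> ->.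
have qM i : i \in l -> (i.2.1.2 %| M)%N.
  by move=> il; rewrite /M (big_rem i) //= dvdn_mulr.
pose e := (i0.2.1.1.2 * (M %/ i0.2.1.2))%N.
have yM : y * U M%:Z = U e%:Z * y.
  rewrite /y /combination mulr_suml mulr_sumr; apply: eq_big_seq => i il.
  rewrite -scalerAl -scalerAr; congr (_ *: _).
  have [i0r i0q] := lP _ i0l; have [ir iq] := lP _ il.
  have eE : e = (i.2.1.1.2 * (M %/ i.2.1.2))%N.
    have := weight_eq i0r i0q ir iq (lw _ _ i0l il).
    have h1 := divnK (qM _ i0l); have h2 := divnK (qM _ il).
    move=> h3; exact: fraction_cross_mul h1 h2 h3 (P_gt0 i0q) (P_gt0 iq).
  have -> : M = (i.2.1.2 * (M %/ i.2.1.2))%N by rewrite mulnC divnK ?qM.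
  by rewrite eE !PoszM term_zpow.
have spn : (s p ^+ M)^`* * s p ^+ M = 1.
  elim: (M) => [|n IH]; first by rewrite expr0 star1 mulr1.
  by rewrite exprS starM -mulrA (mulrA (s p)^`*) (br_isometry rel) // mul1r.
have xsn : x * s p ^+ M = s p ^+ M * x.
  elim: (M) => [|n IH]; first by rewrite expr0 mulr1 mul1r.
  by rewrite exprS mulrA xs -mulrA IH mulrA.
(* the exponent of [s p] only has to satisfy [M < p ^ n], and [n = M] will do *)
have xM : x * U M%:Z * s p ^+ M = 0.
  by apply: defect_zpow_gen => //; rewrite M0 ltn_expl.
have n1 (z v : A) : v^`* * v = 1 -> cnorm (z * v) <= cnorm z.
  move=> v1; apply: le_trans (cnormM_le _ _) _.
  by rewrite (cnorm_isometry v1) mulr1.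
have h1 : cnorm (y * s p ^+ M) <= cnorm (x - y).
  rewrite -(cnorm_isometryM _ (zpow_isometry uSu uuS e%:Z)) mulrA -yM.
  rewrite -(subr0 (y * _ * _)) -xM -2!mulrBl cnormBC.
  by apply: le_trans (n1 _ _ spn) _; apply: n1; exact: zpow_isometry.
have h2 := n1 (x - y) _ spn.
rewrite -(cnorm_isometryM x spn) -xsn.
have := cnormD_le ((x - y) * s p ^+ M) (y * s p ^+ M).
by rewrite -mulrDl subrK; lra.
Qed.
Lemma defect_zero x : defect x -> x = 0.
Proof.
have hg (jw : nat * R[i]) : exists f : A -> A, `|jw.2| = 1 ->
    [/\ star_hom f, f u = u & forall r, P r -> f (s r) = jw.2 ^+ logn jw.1 r *: s r].
  case: (pselect (`|jw.2| = 1)) => [w1|?]; last by exists idfun.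
  have [f hf] := gauge_hom_exists (valuation_multiplicative jw.1 w1).
  by exists f.
have [g gP] := choice hg.
apply: (@stable_subspace_zero _ _ _ (fun j w => g (j, w)) (term u s) weight (admissible P) defect).
- by move=> j w w1; have [fh _ _] := gP (j, w) w1; exact: star_hom_linear.
- by move=> j w y w1; have [fh _ _] := gP (j, w) w1; exact: star_hom_contractive.
- move=> j w [[[a r] q] b] w1 [/= Pr Pq]; have [fh fu fs] := gP (j, w) w1.
  rewrite (gauge_term (c := fun r => w ^+ logn j r) _ _ fh fu fs Pr Pq).
  congr (_ *: _); have w0 : w != 0 by rewrite -normr_eq0 w1 oner_eq0.
  rewrite /weight /= expfzDr // -exprnN -exprVn rmorphXn; congr (_ * _ ^+ _).
  by rewrite [RHS]invC_norm w1 expr1n invr1 mul1r.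
- move=> c y z [ys yU] [zs zU]; split.
    by rewrite mulrDl mulrDr -scalerAl -scalerAr ys zs.
  by move=> k kp; rewrite !mulrDl -!scalerAl yU // zU // scaler0 addr0.
- move=> j w y w1 [ys yU]; have [fh fu fs] := gP (j, w) w1.
  have c0 : w ^+ logn j p != 0 by rewrite expf_neq0 // -normr_eq0 w1 oner_eq0.
  have gsp : s p = (w ^+ logn j p)^-1 *: g (j, w) (s p).
    by rewrite fs // scalerA mulVf // scale1r.
  split.
    by rewrite gsp -scalerAr -scalerAl -!(star_homM _ _ fh) ys.
  move=> k kp; have -> : U k%:Z = g (j, w) (U k%:Z) by rewrite (star_hom_zpow _ _ fh) fu.
  by rewrite gsp -scalerAr -!(star_homM _ _ fh) yU // (star_hom0 fh) scaler0.
- move=> [[[a r] q] b] [/= Pr Pq]; exists (r + q)%N => j; rewrite /weight /=.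
  have h1 : (logn j r < r)%N by rewrite ltn_logl // P_gt0.
  have h2 : (logn j q < q)%N by rewrite ltn_logl // P_gt0.
  split; first by move: h1 h2; lia.
  move=> rqj.
  have h0 n : (0 < n)%N -> (n <= j)%N -> n != j -> logn j n = 0%N.
    move=> n0 nj nej; apply/eqP; rewrite -leqn0 leqNgt logn_gt0 mem_primes n0 /=.
    by apply/negP => /andP[_ /dvdn_leq]; lia.
  by rewrite !h0 ?P_gt0 //; have := P_gt0 Pr; have := P_gt0 Pq; lia.
- move=> y e _ e0.
  have [l lP yl] := term_span_dense rel P_mon P_gt0 (bq_generated QP) y e0.
  by exists l => //; exact: ltW.
- by move=> y l Xy lP lw; exact: defect_homogeneous.
Qed.

(** The elements [f u] and [u] agree on the range of [u^k s_p] for [k < p - 1],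
    because [f] fixes both [u^k s_p] and [u^(k+1) s_p].  Applying [f] to
    [u^p s_p = s_p u] gives [f u (u^(p-1) s_p) = s_p (f u)].  In terms of
    [f u u^* - 1] these are the defining conditions of [defect]. *)
Lemma endo_fixes_unitary (f : A -> A) : star_hom f ->
  (forall k, (k < p)%N -> f (U k%:Z * s p) = U k%:Z * s p) -> f u = u.
Proof.
move=> fh fT.
have fsp : f (s p) = s p by have := fT 0%N (ltnW p1); rewrite /= expr0 mul1r.
have fUk k : (k < p)%N -> f u * U k%:Z * s p = f (U k.+1%:Z * s p).
  move=> kp; rewrite -mulrA -fT // -(star_homM _ _ fh) mulrA; congr (f (_ * _)).
  by rewrite -addn1 addnC PoszD UD zpow1.
have fup : f (U p%:Z * s p) = s p * f u.
  by rewrite -[p%:Z]mulr1 -(br_I rel) // zpow1 (star_homM _ _ fh) fsp.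
suff : f u * u^`* - 1 = 0.
  by move=> /eqP; rewrite subr_eq0 => /eqP h; rewrite -[LHS]mulr1 -uSu mulrA h mul1r.
have uE : u^`* = U (-1) by rewrite -[u in LHS](zpow1 u) zpow_star.
apply: defect_zero; split.
  rewrite mulrBl mulrBr mul1r mulr1; congr (_ - _).
  have -> : f u * u^`* * s p = f u * U (p.-1)%:Z * s p * u^`*.
    rewrite uE -!mulrA (br_I rel) // [U _ * (U _ * _)]mulrA -UD; congr (_ * (zpow u _ * _)).
    by have := P_gt0 Pp; lia.
  by rewrite fUk ?prednK ?P_gt0 // fup mulrA.
move=> k /andP[k0 kp]; rewrite !mulrBl mul1r.
have -> : f u * u^`* * U k%:Z * s p = f u * U (k.-1)%:Z * s p.
  rewrite uE -[f u * _ * _]mulrA -UD; congr (_ * zpow u _ * _); lia.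
by rewrite fUk ?prednK // ?fT ?subrr //; lia.
Qed.

End Defect.
End Rigidity.

(** * Intertwiners are multiples of the generating isometries *)

Section ScalarMultiples.
Local Open Scope classical_set_scope.
Local Open Scope ring_scope.
Variables (R : realType).
Notation normc := ComplexField.Normc.normc.

Lemma cauchy_inv_converges (a : nat -> R) :
  (forall m n, `|a m - a n| <= m.+1%:R^-1 + n.+1%:R^-1) ->
  exists l, forall n, `|a n - l| <= n.+1%:R^-1.
Proof.
move=> aC; have acvg : cvgn a.
  apply/cauchy_cvgP/cauchy_exP => e e0.
  have e2 : 0 < e / 2 by rewrite divr_gt0.
  pose N := Num.truncn (e / 2)^-1.
  have hN : N.+1%:R^-1 < e / 2.
    by rewrite -[ltRHS]invrK ltf_pV2 ?posrE ?invr_gt0 ?ltr0n // truncnS_gt.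
  exists (a N); exists N => // n /= Nn; rewrite /ball /=.
  apply: le_lt_trans (aC N n) _; rewrite [e]splitr ltrD //.
  by apply: le_lt_trans hN; rewrite lef_pV2 ?posrE ?ltr0n // ler_nat.
exists (limn a) => n; apply/ler_addgt0Pl => e e0.
have e2 : 0 < e / 2 by rewrite divr_gt0.
have /cvgrPdist_lt /(_ _ e2)[N1 _ hN1] := acvg.
pose N2 := Num.truncn (e / 2)^-1; pose N := maxn N1 N2.
have h1 : `|limn a - a N| < e / 2 by apply: hN1; rewrite /= leq_maxl.
have h2 : N.+1%:R^-1 <= e / 2.
  rewrite -[leRHS]invrK lef_pV2 ?posrE ?invr_gt0 ?ltr0n //.
  apply/ltW/(lt_le_trans (truncnS_gt _)); by rewrite ler_nat ltnS leq_maxr.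
apply: le_trans (ler_distD (a N) _ _) _; rewrite distrC in h1.
apply: le_trans (lerD (aC n N) (ltW h1)) _.
by rewrite -addrA [leRHS]addrC lerD2l [leRHS]splitr lerD2r.
Qed.

Lemma ReIm_normc_le (c : R[i]) : `|complex.Re c| <= normc c /\ `|complex.Im c| <= normc c.
Proof.
case: c => x y /=; rewrite -!sqrtr_sqr; split; apply: ler_wsqrtr.
  by rewrite lerDl sqr_ge0.
by rewrite lerDr sqr_ge0.
Qed.

Lemma normc_ReIm_le (c : R[i]) : normc c <= `|complex.Re c| + `|complex.Im c|.
Proof.
case: c => x y /=; rewrite -[leRHS]ger0_norm ?addr_ge0 // -sqrtr_sqr ler_wsqrtr //.
by rewrite sqrrD !real_normK ?num_real // lerD2r lerDl mulrn_wge0 // mulr_ge0.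
Qed.

Lemma scalar_multiple_closed (A : cstarAlgType R) (v t : A) : v^`* * v = 1 ->
  (forall e : R, 0 < e -> exists c : R[i], cnorm (t - c *: v) <= e) ->
  exists c : R[i], t = c *: v.
Proof.
move=> v1 tv; have normv (c : R[i]) : cnorm (c *: v) = normc c.
  by rewrite cnormZ (cnorm_isometry v1) mulr1.
have /choice[c cP] (n : nat) : exists c : R[i], cnorm (t - c *: v) <= n.+1%:R^-1.
  by apply: tv; rewrite invr_gt0 ltr0n.
have cC m n : normc (c m - c n) <= m.+1%:R^-1 + n.+1%:R^-1.
  rewrite -normv scalerBl; apply: le_trans (cnorm_triangle t _ _) _.
  by rewrite cnormBC lerD.
have [|a aP] := @cauchy_inv_converges (fun n => complex.Re (c n)).
  move=> m n; have := le_trans (ReIm_normc_le (c m - c n)).1 (cC m n).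
  by case: (c m) (c n) => ? ? [].
have [|b bP] := @cauchy_inv_converges (fun n => complex.Im (c n)).
  move=> m n; have := le_trans (ReIm_normc_le (c m - c n)).2 (cC m n).
  by case: (c m) (c n) => ? ? [].
exists (a +i* b)%C; apply/eqP; rewrite -subr_eq0; apply/eqP/cnorm_small => e e0.
have e3 : 0 < e / 3 by rewrite divr_gt0.
pose N := Num.truncn (e / 3)^-1.
have hN : N.+1%:R^-1 <= e / 3.
  rewrite -[leRHS]invrK lef_pV2 ?posrE ?invr_gt0 ?ltr0n //; exact/ltW/truncnS_gt.
apply: le_trans (cnorm_triangle (c N *: v) _ _) _; rewrite -scalerBl normv.
have h1 := normc_ReIm_le (c N - (a +i* b)%C); have h2 := aP N; have h3 := bP N.
have h4 := cP N; case: (c N) h1 h2 h3 h4 => x y /= h1 h2 h3 h4.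
apply: le_trans (lerD h4 (le_trans h1 (lerD h2 h3))) _.
by apply: le_trans (lerD hN (lerD hN hN)) _; lra.
Qed.

End ScalarMultiples.

Section Commutant.
Local Open Scope classical_set_scope.
Local Open Scope ring_scope.
Variables (R : realType) (P : set nat) (A : cstarAlgType R) (u : A) (s : nat -> A).
Hypothesis QP : boundary_quotient P u s.
Hypothesis P_mon : nat_submonoid P.
Hypothesis P_gt0 : forall p, P p -> (0 < p)%N.

Notation U := (zpow u).
Notation normc := ComplexField.Normc.normc.

Let rel : boundary_relations P u s := bq_relations QP.
Let uSu := br_unitary_l rel.
Let uuS := br_unitary_r rel.
Let UD m n : U (m + n) = U m * U n. Proof. exact: zpowD. Qed.
Let U0 : U 0 = 1. Proof. by rewrite /= expr0. Qed.

(** If the affine map [j |-> a + (r / q) (j + b)] sends a multiple of [g] to a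
    multiple of [g], then [q a + r b] is a multiple of [g] too. *)
Lemma term_compress g a r q b : P g -> P r -> P q ->
  ~~ (g%:Z %| q%:Z * a + r%:Z * b)%Z -> (s g)^`* * term u s (a, r, q, b) * s g = 0.
Proof.
move=> Pg Pr Pq ng; rewrite -[LHS]mulr1 -(gen_unfold rel Pq) mulr_sumr big1 // => k _.
rewrite -[U _ * _ * _ * _]mulrA mulrA.
suff -> : (s g)^`* * term u s (a, r, q, b) * s g * (U k%:Z * s q) = 0 by rewrite mul0r.
have -> : (s g)^`* * term u s (a, r, q, b) * s g * (U k%:Z * s q) =
    (s g)^`* * U a * s r * ((s q)^`* * U (b + g%:Z * k%:Z) * s q) * s g.
  rewrite /term UD !mulrA -[_ * s g * U _]mulrA (br_I rel) //.
  by rewrite -!mulrA (gen_commute rel Pg Pq) !mulrA.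
rewrite (gen_compress rel P_gt0) //; case: ifP => [/dvdzP[e eE]|_]; last by rewrite mulr0 mul0r.
rewrite eE mulzK; last by rewrite -lt0n P_gt0.
rewrite -(mulrA _ (s r)) (br_I rel) // !mulrA -[_ * U _ * U _]mulrA -UD.
rewrite -[_ * s r * s g]mulrA (gen_commute rel Pr Pg) mulrA.
rewrite (gen_compress rel P_gt0) //; case: ifP => [h|_]; last by rewrite mul0r.
case/negP: ng.
have -> : q%:Z * a + r%:Z * b = q%:Z * (a + r%:Z * e) - r%:Z * (g%:Z * k%:Z).
  have -> : q%:Z * (a + r%:Z * e) = q%:Z * a + r%:Z * (e * q%:Z) by ring.
  by rewrite -eE; ring.
by apply: rpredB; apply: dvdz_mull => //; apply: dvdz_mulr.
Qed.

Lemma gen_unfold_multiple q k : P q ->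
  \sum_(j < k * q) U j%:Z * s q * (s q)^`* * U (- j%:Z) = k%:R.
Proof.
move=> Pq; rewrite -(big_mkord xpredT (fun j => U j%:Z * s q * (s q)^`* * U (- j%:Z))).
rewrite big_nat_mul big_mkord (eq_bigr (fun=> 1)) ?sumr_const ?card_ord // => i _.
rewrite mulSn addnC -{1}[(i * q)%N]add0n big_addn addKn big_mkord.
rewrite -[RHS](gen_unfold rel Pq); apply: eq_bigr => j _.
have -> : U (j + i * q)%N%:Z = U j%:Z * U (q%:Z * i%:Z).
  by rewrite -UD -PoszM -PoszD mulnC.
have -> : U (- (j + i * q)%N%:Z) = U (- (q%:Z * i%:Z)) * U (- j%:Z).
  by rewrite -UD; congr (zpow u _); rewrite PoszD PoszM; ring.
rewrite !mulrA -[_ * U (_ * _) * _]mulrA -(br_I rel) // !mulrA.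
rewrite -[_ * (s q)^`* * U _]mulrA -mulrN (gen_starU rel) // !mulrA.
by rewrite -[_ * U i%:Z * U _]mulrA -UD subrr U0 mulr1.
Qed.

Variables (p q : nat) (t : A).
Hypotheses (Pp : P p) (p1 : (1 < p)%N) (Pq : P q).
Hypotheses (tu : t * u = U q%:Z * t) (tsp : t * s p = s p * t).

Lemma intertwiner_zpow m : t * U m = U (q%:Z * m) * t.
Proof.
have tus : t * u^`* = U (- q%:Z) * t.
  rewrite -[t in LHS]mul1r -{1}(zpowNl uSu uuS q%:Z) -[U _ * _ * t]mulrA -tu.
  by rewrite -!mulrA uuS mulr1.
elim/int_rect: m => [|n IH|n IH]; first by rewrite mulr0 !U0 mulr1 mul1r.
  by rewrite -addn1 PoszD zpow_addr1 // mulrA IH -mulrA tu mulrA -UD mulrDr mulr1.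
have -> : - n.+1%:Z = - n%:Z - 1 by rewrite intS opprD addrC.
by rewrite zpow_subr1 // mulrA IH -mulrA tus mulrA -UD mulrDr mulrN1.
Qed.

Lemma submonoid_expn n : P (p ^ n)%N.
Proof. by elim: n => [|n IH]; [exact: P_mon.1 | rewrite expnS; apply: P_mon.2]. Qed.

Lemma intertwiner_gen n : t * s (p ^ n)%N = s (p ^ n)%N * t.
Proof.
elim: n => [|n IH]; first by rewrite expn0 (br_one rel) mulr1 mul1r.
by rewrite expnS -(br_mul rel Pp (submonoid_expn n)) mulrA tsp -[LHS]mulrA IH mulrA.
Qed.

Section Expectation.
Variables (K M n : nat).
Hypothesis K0 : (0 < K)%N.
Let g := (p ^ n)%N.
Let Pg : P g := submonoid_expn n.

(** Averaging [u^(qj) x u^(-j)] over [j < K] turns a term [s_q E], with [E] a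
    diagonal projection, into a multiple of [s_q]; the corner of the translate by
    [M] for the range of [s_g] kills the other terms.  Neither operation moves
    [t]. *)
Definition squeeze (x : A) : A := (K%:R^-1 : R[i]) *:
  \sum_(j < K) (s g)^`* * (U (q%:Z * (j%:Z - M%:Z)) * x * U (M%:Z - j%:Z)) * s g.

Lemma squeeze_linear : linear squeeze.
Proof.
move=> c x y; rewrite /squeeze scalerA mulrC -scalerA -scalerDr; congr (_ *: _).
rewrite scaler_sumr -big_split; apply: eq_bigr => j _ /=.
by rewrite !(mulrDl, mulrDr) -!(scalerAl, scalerAr).
Qed.

Lemma squeeze_norm x : cnorm (squeeze x) <= cnorm x.
Proof.
rewrite /squeeze cnormZ; rewrite normc_natV.
rewrite mulrC ler_pdivrMr ?ltr0n //; apply: le_trans (cnorm_sum _ _ _) _.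
apply: le_trans (_ : \sum_(k < K) cnorm x <= _); last by rewrite sumr_const card_ord mulr_natr.
apply: ler_sum => j _; apply: le_trans (cnormM_le1 _ _ _) _.
- by rewrite cnorm_star (cnorm_gen rel).
- by rewrite (cnorm_gen rel).
- by apply: cnormM_le1; rewrite (cnorm_zpow uSu uuS).
Qed.

Lemma squeeze_const (x : A) :
  (forall j : 'I_K, (s g)^`* * (U (q%:Z * (j%:Z - M%:Z)) * x * U (M%:Z - j%:Z)) * s g = x) ->
  squeeze x = x.
Proof.
move=> h; rewrite /squeeze (eq_bigr (fun=> x)) ?sumr_const ?card_ord; last by move=> j _; apply: h.
by rewrite -[x *+ K]scaler_nat scalerA mulVf ?scale1r // pnatr_eq0 -lt0n.
Qed.

Lemma squeeze_intertwiner : squeeze t = t.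
Proof.
apply: squeeze_const => j; rewrite -[U _ * t * _]mulrA intertwiner_zpow [U _ * (U _ * t)]mulrA -UD -mulrDr.
have -> : j%:Z - M%:Z + (M%:Z - j%:Z) = 0 by ring.
by rewrite mulr0 U0 mul1r -mulrA intertwiner_gen mulrA (br_isometry rel) // mul1r.
Qed.

(** The displayed number is [q' a + r b] for the translate of the term by
    [u^(q (j - M))] on the left and [u^(M - j)] on the right. *)
Lemma squeeze_offdiagonal a r q' b : P r -> P q' ->
  (forall j, (j < K)%N -> ~~ (g%:Z %|
     (q'%:Z * a + r%:Z * b) + (r%:Z - q%:Z * q'%:Z) * (M%:Z - j%:Z))%Z) ->
  squeeze (term u s (a, r, q', b)) = 0.
Proof.
move=> Pr Pq' hF; rewrite /squeeze big1 ?scaler0 // => j _.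
have -> : U (q%:Z * (j%:Z - M%:Z)) * term u s (a, r, q', b) * U (M%:Z - j%:Z) =
    term u s (q%:Z * (j%:Z - M%:Z) + a, r, q', b + (M%:Z - j%:Z)).
  by rewrite /term !UD !mulrA.
apply: term_compress => //; have := hF j (ltn_ord j); congr (~~ (_ %| _)%Z); ring.
Qed.

(** Such a term is [s_q] times the projection [u^(-b) s_q' s_q'^* u^b], whose
    [q'] translates sum to [1] by relation (III). *)
Lemma squeeze_diagonal q' b : P q' -> (q' %| K)%N ->
  exists c : R[i], squeeze (term u s (- (q%:Z * b), (q * q')%N, q', b)) = c *: s q.
Proof.
move=> Pq' /dvdnP[k KE]; exists (k%:R / K%:R).
have sumE : \sum_(j < K) U (q%:Z * j%:Z) *
    term u s (- (q%:Z * b), (q * q')%N, q', b) * U (- j%:Z) = (k%:R : R[i]) *: s q.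
  have termE : term u s (- (q%:Z * b), (q * q')%N, q', b) =
      s q * (U (- b) * s q' * (s q')^`* * U b).
    by rewrite /term -(br_mul rel) // -mulrN !mulrA -(br_I rel).
  rewrite termE; under eq_bigr => j _ do rewrite mulrA -(br_I rel) // -2!(mulrA (s q)).
  rewrite -mulr_sumr.
  have -> : \sum_(j < K) U j%:Z * (U (- b) * s q' * (s q')^`* * U b) * U (- j%:Z) =
      U (- b) * (\sum_(j < K) U j%:Z * s q' * (s q')^`* * U (- j%:Z)) * U b.
    rewrite mulr_sumr mulr_suml; apply: eq_bigr => j _.
    rewrite !mulrA (zpowC uSu uuS j) -!mulrA; do 4!congr (_ * _).
    by rewrite (zpowC uSu uuS b).
  by rewrite KE gen_unfold_multiple // mulr_natr mulrnAl (zpowNl uSu uuS) mulr_natr scaler_nat.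
rewrite /squeeze.
have -> : \sum_(j < K) (s g)^`* * (U (q%:Z * (j%:Z - M%:Z)) *
      term u s (- (q%:Z * b), (q * q')%N, q', b) * U (M%:Z - j%:Z)) * s g =
    (s g)^`* * (U (- (q%:Z * M%:Z)) * (\sum_(j < K) U (q%:Z * j%:Z) *
      term u s (- (q%:Z * b), (q * q')%N, q', b) * U (- j%:Z)) * U M%:Z) * s g.
  rewrite mulr_sumr mulr_suml mulr_sumr mulr_suml; apply: eq_bigr => j _.
  rewrite mulrBr [_ - _ * M%:Z]addrC [M%:Z - _]addrC !UD.
  by rewrite !mulrA.
rewrite sumE -!(scalerAl, scalerAr) scalerA mulrC; congr (_ *: _).
rewrite -mulrN -(br_I rel) // -[s q * _ * _]mulrA (zpowNl uSu uuS) mulr1.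
by rewrite -mulrA (gen_commute rel Pq Pg) mulrA (br_isometry rel) // mul1r.
Qed.

End Expectation.

Lemma dvd_gap (x z : int) (D k g : nat) : (`|x| < D)%N -> (D < `|z|)%N ->
  (`|z| <= k)%N -> (D + k < g)%N -> (g %| `|(x + z)%R|)%N -> False.
Proof.
move=> h1 h2 h3 h4; have pos : (0 < `|(x + z)%R|)%N by lia.
by move=> /(dvdn_leq pos); lia.
Qed.

(** For a term with [r <> q q'], the condition of [squeeze_offdiagonal] concerns
    [x + z] with [x = q' a + r b] bounded by [D] and [z] a nonzero multiple of
    [M - j > D]; hence [x + z] is not zero, and it is less than [g] in absolute
    value, by the choice of [n]. *)
Lemma intertwiner_approx (e : R) : 0 < e -> exists c : R[i], cnorm (t - c *: s q) <= e.
Proof.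
move=> e0; have [l lP tl] := term_span_dense rel P_mon P_gt0 (bq_generated QP) t e0.
pose f1 (i : R[i] * (int * nat * nat * int)) : int :=
  i.2.1.2%:Z * i.2.1.1.1 + i.2.1.1.2%:Z * i.2.2.
pose f2 (i : R[i] * (int * nat * nat * int)) : int :=
  i.2.1.1.2%:Z - q%:Z * i.2.1.2%:Z.
pose D := (\sum_(i <- l) (`|f1 i| + `|f2 i|))%N.+1.
have DP i : i \in l -> (`|f1 i| < D)%N /\ (`|f2 i| < D)%N.
  by move=> il; rewrite /D (big_rem i) //=; split; lia.
pose K := (\prod_(i <- l) i.2.1.2)%N.
have K0 : (0 < K)%N.
  by rewrite /K big_seq; elim/big_ind: _ => [//|a b|i /lP[_ /P_gt0]] //; rewrite muln_gt0 => -> ->.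
have KP i : i \in l -> (i.2.1.2 %| K)%N.
  by move=> il; rewrite /K (big_rem i) //= dvdn_mulr.
pose M := (K + D)%N; pose n := (D + D * (K + D))%N.
have gn : (n < p ^ n)%N by exact: ltn_expl.
have sqP i : i \in l -> exists c : R[i], squeeze K M n (term u s i.2) = c *: s q.
  move=> il; have [d1 d2] := DP i il; have Ki := KP i il; have [Pr Pq'] := lP i il.
  move: d1 d2; rewrite /f1 /f2; case: i il Ki Pr Pq' => c0 [[[a r] q'] b] /= il Ki Pr Pq' d1 d2.
  have [rq|rq] := eqVneq (r%:Z - q%:Z * q'%:Z) 0; last first.
    exists 0; rewrite scale0r squeeze_offdiagonal // => j jK.
    rewrite dvdzE /=; apply/negP => h.
    set x := q'%:Z * a + _ in d1 h; set y := r%:Z - _ in d2 h rq.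
    have yz : (`|(y * (M%:Z - j%:Z))%R| = `|y| * (M - j))%N.
      by rewrite abszM; congr (_ * _)%N; rewrite /M; lia.
    have y0 : (0 < `|y|)%N by rewrite absz_gt0.
    have big1 : (D < M - j)%N by rewrite /M; lia.
    have big2 : (M - j <= `|y| * (M - j))%N by rewrite leq_pmull.
    have big3 : (`|y| * (M - j) <= D * (K + D))%N.
      by apply: leq_mul; [exact: ltnW | rewrite /M leq_subr].
    rewrite -yz in big2 big3.
    exact: (dvd_gap d1 (leq_trans big1 big2) big3 gn h).
  have rE : r = (q * q')%N by lia.
  have [F0|F0] := eqVneq (q'%:Z * a + r%:Z * b) 0; last first.
    exists 0; rewrite scale0r squeeze_offdiagonal // => j jK.
    rewrite rq mul0r addr0 dvdzE /=; apply/negP => /dvdn_leq.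
    by move: gn; rewrite /n absz_gt0 F0; lia.
  have aE : a = - (q%:Z * b).
    have q'0 : q'%:Z != 0 by rewrite -lt0n P_gt0.
    apply: (mulfI q'0); apply/eqP; rewrite -subr_eq0 -F0 rE PoszM; apply/eqP; ring.
  by rewrite rE aE; apply: squeeze_diagonal.
have [c cE] : exists c : R[i], squeeze K M n (combination (term u s) l) = c *: s q.
  rewrite /combination (linear_sum_map (squeeze_linear K M n) _ _) big_seq.
  elim/big_ind: _ => [|x y [cx ->] [cy ->]|i il]; first by exists 0; rewrite scale0r.
    by exists (cx + cy); rewrite scalerDl.
  have [ci ciE] := sqP i il; exists (i.1 * ci).
  by rewrite (linear_scale_map (squeeze_linear K M n) _ _) ciE scalerA.
exists c; rewrite -cE -[X in X - _](squeeze_intertwiner M n K0).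
rewrite -(linear_sub_map (squeeze_linear K M n) _ _).
exact: le_trans (squeeze_norm _ _ K0 _) (ltW tl).
Qed.

Theorem intertwiner_scalar : exists c : R[i], t = c *: s q.
Proof. exact: scalar_multiple_closed (br_isometry rel Pq) intertwiner_approx. Qed.

End Commutant.

(** * Characters of the monoids *)

Section Monoids.
Local Open Scope classical_set_scope.
Variable S : set nat.

Lemma monoid_generatedP (M : set nat) : nat_submonoid M -> S `<=` M ->
  monoid_generated S `<=` M.
Proof. by move=> hM SM x; apply; split. Qed.

Lemma sub_monoid_generated : S `<=` monoid_generated S.
Proof. by move=> x Sx M [_]; apply. Qed.

Lemma monoid_generated_submonoid : nat_submonoid (monoid_generated S).
Proof.
split=> [M [[]]//|p q Pp Pq M hM]; case: (hM) => -[_ MM] _.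
by apply: MM; [apply: Pp | apply: Pq].
Qed.

Hypothesis S_gt1 : forall p, S p -> (1 < p)%N.

Lemma monoid_generated_gt0 p : monoid_generated S p -> (0 < p)%N.
Proof.
move=> /(@monoid_generatedP [set n | (0 < n)%N]); apply.
  by split=> // a b /=; rewrite muln_gt0 => -> ->.
by move=> a /S_gt1 /ltnW.
Qed.

End Monoids.

Lemma monoid_generatedS (S1 S2 : set nat) : (S1 `<=` S2)%classic ->
  (monoid_generated S1 `<=` monoid_generated S2)%classic.
Proof.
move=> S12; apply: monoid_generatedP; first exact: monoid_generated_submonoid.
by move=> x /S12; apply: sub_monoid_generated.
Qed.

Section Characters.
Local Open Scope classical_set_scope.
Local Open Scope ring_scope.
Variables (R : realType).

Lemma multiplicative_on_conj (P : set nat) (c : nat -> R[i]) :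
  multiplicative_on P c -> multiplicative_on P (fun p => Num.conj (c p)).
Proof.
move=> [h1 h2 h3]; split=> [p Pp||p q Pp Pq]; rewrite ?norm_conjC ?h1 //.
  by rewrite h2 rmorph1.
by rewrite h3 // rmorphM.
Qed.

Lemma multiplicative_on_sub (P Q : set nat) (c : nat -> R[i]) : Q `<=` P ->
  multiplicative_on P c -> multiplicative_on Q c.
Proof. by move=> QP [h1 h2 h3]; split=> // [p /QP/h1|p q /QP Pp /QP Pq]; last exact: h3. Qed.

Variable Q : set nat.
Hypothesis Q_mon : nat_submonoid Q.
Hypothesis Q_gt0 : forall p, Q p -> (0 < p)%N.

Lemma dual_multiplicative (chi : rat -> R[i]) : pontryagin_dual Q chi ->
  multiplicative_on Q (fun q => chi q%:R).
Proof.
move=> [chi1 chiM]; have gQ q : Q q -> grothendieck_group Q q%:R.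
  by move=> Qq; exists q, 1%N; split=> //; [exact: Q_mon.1 | rewrite divr1].
have Q1 := gQ _ Q_mon.1; split=> [p /gQ/chi1//||p q Qp Qq].
  have := chiM _ _ Q1 Q1; rewrite mulr1 => h.
  have n0 : chi 1 != 0 by rewrite -normr_eq0 chi1 ?oner_eq0.
  by apply: (mulfI n0); rewrite -h mulr1.
by rewrite natrM chiM //; apply: gQ.
Qed.

(** The extension [a / b |-> c a / c b] is single-valued: [a b' = a' b] implies
    [c a c b' = c a' c b]. *)
Lemma multiplicative_dual (c : nat -> R[i]) : multiplicative_on Q c ->
  exists2 chi, pontryagin_dual Q chi & forall q, Q q -> chi q%:R = c q.
Proof.
move=> [c1 c_one cM].
have c0 q : Q q -> c q != 0 by move=> Qq; rewrite -normr_eq0 c1 ?oner_eq0.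
have natr0 q : Q q -> q%:R != 0 :> rat by move=> /Q_gt0; rewrite pnatr_eq0 -lt0n.
have /choice[chi chiP] (x : rat) : exists y : R[i], forall a b, Q a -> Q b ->
    x = a%:R / b%:R -> y = c a / c b.
  case: (pselect (grothendieck_group Q x)) => [[a [b [Qa Qb xE]]]|nx].
    exists (c a / c b) => a' b' Qa' Qb'; rewrite xE => /eqP.
    rewrite eqr_div ?natr0 // -!natrM eqr_nat => /eqP ab.
    by apply/eqP; rewrite eqr_div ?c0 // -!cM // ab.
  by exists 0 => a b Qa Qb xE; case: nx; exists a, b.
exists chi; last first.
  move=> q Qq; rewrite (chiP q%:R q 1%N) //; last by rewrite divr1.
    by rewrite c_one divr1.
  exact: Q_mon.1.
split=> [x [a [b [Qa Qb xE]]]|x y [a [b [Qa Qb xE]]] [a' [b' [Qa' Qb' yE]]]].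
  by rewrite (chiP _ _ _ Qa Qb xE) normrM normfV !c1 // invr1 mulr1.
rewrite (chiP _ _ _ Qa Qb xE) (chiP _ _ _ Qa' Qb' yE).
rewrite (chiP (x * y) (a * a')%N (b * b')%N); first by rewrite !cM // invfM mulrACA.
- exact: Q_mon.2.
- exact: Q_mon.2.
by rewrite xE yE !natrM invfM mulrACA.
Qed.

End Characters.

Section ExtendCharacter.
Local Open Scope classical_set_scope.
Local Open Scope ring_scope.
Variables (R : realType) (S S' : set nat).
Hypothesis S_gt1 : forall p, S p -> (1 < p)%N.
Hypothesis S_coprime : forall p q, S p -> S q -> p <> q -> coprime p q.
Hypothesis S'S : S' `<=` S.

Let Q := monoid_generated (S `\` S').

(** Let [pi] be the set of primes that divide a member of [S \ S'].  By
    coprimality no prime of [pi] divides a member of [S'], so that the [pi]-part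
    of a natural number is a multiplicative retraction of [<S>] onto [<S \ S'>]
    that is trivial on [S']. *)
Lemma multiplicative_extend (c : nat -> R[i]) : multiplicative_on Q c ->
  exists c' : nat -> R[i], [/\ multiplicative_on (monoid_generated S) c',
    forall q, Q q -> c' q = c q & forall p, S' p -> c' p = 1].
Proof.
move=> [c1 c_one cM].
pose pi : nat_pred := [pred l : nat | `[< exists q, [/\ S q, ~ S' q & (l %| q)%N] >]].
have Q_mon : nat_submonoid Q by exact: monoid_generated_submonoid.
have gt0 p : monoid_generated S p -> (0 < p)%N by exact: monoid_generated_gt0.
have partS p : S p -> ~ S' p -> (p`_pi = p)%N.
  move=> Sp S'p; apply: part_pnat_id; apply/pnatP; first exact: ltnW (S_gt1 Sp).
  by move=> l _ lp; apply/asboolP; exists p.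
have partS' p : S' p -> (p`_pi = 1)%N.
  move=> S'p; apply: part_p'nat; apply/pnatP; first exact/ltnW/S_gt1/S'S.
  move=> l l_pr lp; apply/negP => /asboolP[q [Sq S'q lq]].
  have pq : p <> q by move=> pq; apply: S'q; rewrite -pq.
  have := S_coprime (S'S S'p) Sq pq; rewrite /coprime => /eqP g1.
  have : (l %| gcdn p q)%N by rewrite dvdn_gcd lp lq.
  by rewrite g1 dvdn1 => /eqP l1; rewrite l1 in l_pr.
have partP r : monoid_generated S r -> Q (r`_pi)%N.
  move=> Pr; suff [] : (0 < r)%N /\ Q (r`_pi)%N by [].
  move: r Pr; apply: (@monoid_generatedP S [set r | (0 < r)%N /\ Q (r`_pi)%N]).
    split=> [|a b /= [a0 Qa] [b0 Qb]]; first by rewrite /= partn1; split=> //; exact: Q_mon.1.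
    by rewrite muln_gt0 a0 b0 partnM //; split=> //; apply: Q_mon.2.
  move=> p Sp /=; split; first exact: ltnW (S_gt1 Sp).
  case: (pselect (S' p)) => S'p; first by rewrite partS' //; exact: Q_mon.1.
  by rewrite partS //; apply: sub_monoid_generated; split.
have partQ r : Q r -> (r`_pi = r)%N.
  move=> Qr; suff [] : (0 < r)%N /\ (r`_pi = r)%N by [].
  move: r Qr; apply: (@monoid_generatedP _ [set r | (0 < r)%N /\ (r`_pi = r)%N]).
    split=> [|a b /= [a0 Qa] [b0 Qb]]; first by rewrite /= partn1.
    by rewrite muln_gt0 a0 b0 partnM // Qa Qb.
  by move=> p [Sp S'p] /=; split; [exact: ltnW (S_gt1 Sp) | exact: partS].
exists (fun r => c (r`_pi)%N); split.
- split=> [p /partP/c1//||p q Pp Pq]; first by rewrite partn1.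
  by rewrite partnM ?gt0 // cM //; apply: partP.
- by move=> q /partQ ->.
- by move=> p /partS' ->.
Qed.

End ExtendCharacter.

(** * Automorphisms and their characters *)

Section Automorphisms.
Local Open Scope classical_set_scope.
Local Open Scope ring_scope.
Variables (R : realType) (P : set nat) (A : cstarAlgType R) (u : A) (s : nat -> A).
Hypothesis QP : boundary_quotient P u s.
Hypothesis P_mon : nat_submonoid P.
Hypothesis P_gt0 : forall p, P p -> (0 < p)%N.
Let rel : boundary_relations P u s := bq_relations QP.

Lemma gauge_aut_exists (c : nat -> R[i]) : multiplicative_on P c ->
  exists f : A -> A, [/\ @star_aut R A f, f u = u & forall p, P p -> f (s p) = c p *: s p].
Proof.
move=> cP; have [f [fh fu fs]] := gauge_hom_exists QP cP.
have [g [gh gu gs]] := gauge_hom_exists QP (multiplicative_on_conj cP).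
have cc p : P p -> Num.conj (c p) * c p = 1.
  by case: cP => c1 _ _ /c1 h; rewrite mulrC -normCK h expr1n.
exists f; split=> //; split=> //; exists g => x.
  have -> // : g (f x) = (g \o f) x by [].
  rewrite (star_hom_ext QP (star_hom_comp gh fh) (star_hom_id A)) //= ?fu //.
  by move=> p Pp; rewrite fs // (star_homZ _ _ gh) gs // scalerA mulrC cc // scale1r.
have -> // : f (g x) = (f \o g) x by [].
rewrite (star_hom_ext QP (star_hom_comp fh gh) (star_hom_id A)) //= ?gu //.
by move=> p Pp; rewrite gs // (star_homZ _ _ fh) fs // scalerA cc // scale1r.
Qed.

Lemma gen_scale_inj p (c c' : R[i]) : P p -> c *: s p = c' *: s p -> c = c'.
Proof.
move=> Pp /eqP; rewrite -subr_eq0 -scalerBl => /eqP h.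
have : ComplexField.Normc.normc (c - c') = 0.
  by rewrite -[LHS]mulr1 -(cnorm_gen rel Pp) -cnormZ h cnorm0.
by move=> /ComplexField.Normc.eq0_normc /eqP; rewrite subr_eq0 => /eqP.
Qed.

(** The generators [u^k s_p] for a single [p] in [S'] already determine the image
    of [u], and with it that of each [s_q] up to a scalar. *)
Lemma endo_fixing_torsion (S' : set nat) (f : A -> A) :
  S' `<=` P -> (forall p, S' p -> (1 < p)%N) -> S' !=set0 -> star_hom f ->
  (forall x, torsion_subalgebra S' u s x -> f x = x) ->
  [/\ f u = u, forall p, S' p -> f (s p) = s p &
      exists2 c, multiplicative_on P c & forall q, P q -> f (s q) = c q *: s q].
Proof.
move=> S'P S'1 [p0 S'p0] fh fT.
have fUs p k : S' p -> (k < p)%N -> f (zpow u k%:Z * s p) = zpow u k%:Z * s p.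
  move=> S'p kp; apply: fT => M [_]; apply; exists p, k; split=> //.
  by have := S'1 _ S'p; lia.
have fu : f u = u.
  by apply: (endo_fixes_unitary QP P_mon P_gt0 (S'P _ S'p0) (S'1 _ S'p0) fh) => k; apply: fUs.
have fs p : S' p -> f (s p) = s p.
  by move=> S'p; have := fUs p 0%N S'p (ltnW (S'1 _ S'p)); rewrite /= expr0 mul1r.
split=> //.
have /choice[c cP] (q : nat) : exists c : R[i], P q -> f (s q) = c *: s q.
  case: (pselect (P q)) => [Pq|?]; last by exists 0.
  have [||c ->] := intertwiner_scalar QP P_mon P_gt0 (S'P _ S'p0) (S'1 _ S'p0) Pq (t := f (s q)).
  - rewrite -[X in _ * X]fu -(star_homM _ _ fh) -[u in LHS](zpow1 u) (br_I rel) // mulr1.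
    by rewrite (star_homM _ _ fh) (star_hom_zpow _ _ fh) fu.
  - rewrite -[X in _ * X](fs _ S'p0) -[X in _ = X * _](fs _ S'p0) -!(star_homM _ _ fh).
    by rewrite (gen_commute rel Pq (S'P _ S'p0)).
  by exists c.
exists c => //; split=> [q Pq||q r Pq Pr].
- have : cnorm (f (s q)) = 1.
    by apply: cnorm_isometry; rewrite -star_homS // -star_homM // (br_isometry rel) // star_hom1.
  by rewrite cP // cnormZ (cnorm_gen rel Pq) mulr1 => /normc_eqP ->.
- have P1 := P_mon.1; apply: (gen_scale_inj P1).
  by rewrite scale1r -cP // (br_one rel) star_hom1.
- apply: (gen_scale_inj (P_mon.2 _ _ Pq Pr)); rewrite -cP; last exact: P_mon.2.
  by rewrite -(br_mul rel Pq Pr) (star_homM _ _ fh) !cP // -scalerAl -scalerAr scalerA.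
Qed.

End Automorphisms.

Section Main.
Local Open Scope classical_set_scope.
Local Open Scope ring_scope.
Variables (R : realType) (S : set nat).
Hypothesis S_gt1 : forall p, S p -> (1 < p)%N.
Hypothesis S_coprime : forall p q, S p -> S q -> p <> q -> coprime p q.
Variables (A : cstarAlgType R) (u : A) (s : nat -> A).
Hypothesis QP : boundary_quotient (monoid_generated S) u s.

Let P := monoid_generated S.
Let P_mon : nat_submonoid P. Proof. exact: monoid_generated_submonoid. Qed.
Let P_gt0 p : P p -> (0 < p)%N. Proof. exact: monoid_generated_gt0. Qed.
Let rel : boundary_relations P u s := bq_relations QP.

Lemma star_hom_ext_gen (f g : A -> A) : star_hom f -> star_hom g -> f u = g u ->
  (forall p, S p -> f (s p) = g (s p)) -> f = g.
Proof.
move=> fh gh fgu fgs; apply: (star_hom_ext QP fh gh fgu) => p Pp.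
suff [] : P p /\ f (s p) = g (s p) by [].
move: p Pp; apply: (@monoid_generatedP S [set p | P p /\ f (s p) = g (s p)]).
  split=> [|a b /= [Pa fa] [Pb fb]].
    by split; [exact: P_mon.1 | rewrite (br_one rel) !star_hom1].
  split; first exact: P_mon.2.
  by rewrite -(br_mul rel Pa Pb) (star_homM _ _ fh) (star_homM _ _ gh) fa fb.
by move=> p Sp; split; [exact: sub_monoid_generated | exact: fgs].
Qed.

Lemma torsion_fixing_trivial : S !=set0 ->
  star_aut_fixing (torsion_subalgebra S u s) = [set idfun].
Proof.
move=> S0; apply/seteqP; split=> [f [[fh _] fT]|_ ->] /=.
  have [fu fs _] := endo_fixing_torsion QP P_mon P_gt0 (@sub_monoid_generated S) S_gt1 S0 fh fT.
  by apply: star_hom_ext_gen => //; exact: star_hom_id.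
by split.
Qed.

Section Correspondence.
Variable S' : set nat.
Hypotheses (S'0 : S' !=set0) (S'S : S' `<=` S).
Let Q := monoid_generated (S `\` S').
Variables (B : cstarAlgType R) (v : B) (t : nat -> B).
Hypothesis QQ : boundary_quotient Q v t.

Let Q_mon : nat_submonoid Q. Proof. exact: monoid_generated_submonoid. Qed.
Let Q_sub : Q `<=` P. Proof. by apply: monoid_generatedS => x []. Qed.
Let Q_gt0 p : Q p -> (0 < p)%N. Proof. by move/Q_sub/P_gt0. Qed.

(** The graph of the isomorphism: [f] and [h] have the same character on [Q]. *)
Definition same_eigenvalues (f : A -> A) (h : B -> B) :=
  [/\ star_hom h, h v = v &
      forall q, Q q -> exists2 c : R[i], f (s q) = c *: s q & h (t q) = c *: t q].

Lemma same_eigenvalues_unique f h h' :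
  same_eigenvalues f h -> same_eigenvalues f h' -> h = h'.
Proof.
move=> [hh hv ht] [h'h h'v h't]; apply: (star_hom_ext QQ) => // [|q Qq].
  by rewrite hv.
have [c fc ->] := ht q Qq; have [c' fc' ->] := h't q Qq.
by rewrite (gen_scale_inj QP (Q_sub Qq) (c := c) (c' := c')) // -fc.
Qed.

Lemma same_eigenvalues_comp f f' h h' : star_hom f ->
  same_eigenvalues f h -> same_eigenvalues f' h' ->
  same_eigenvalues (f \o f') (h \o h').
Proof.
move=> fh [hh hv ht] [h'h h'v h't]; split; first exact: star_hom_comp.
  by rewrite /= h'v.
move=> q Qq; have [c fc hc] := ht q Qq; have [c' fc' hc'] := h't q Qq.
exists (c' * c) => /=; rewrite ?fc' ?hc'.
  by rewrite (star_homZ _ _ fh) fc scalerA.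
by rewrite (star_homZ _ _ hh) hc scalerA.
Qed.

Let G := star_aut_fixing (torsion_subalgebra S' u s).
Let H := gauge_automorphisms Q v t.

Let fixing (f : A -> A) : G f -> [/\ f u = u, forall p, S' p -> f (s p) = s p &
  exists2 c, multiplicative_on P c & forall q, P q -> f (s q) = c q *: s q].
Proof.
move=> [[fh _] fT]; apply: (endo_fixing_torsion QP P_mon P_gt0 _ _ S'0 fh fT).
  by move=> p /S'S; apply: sub_monoid_generated.
by move=> p /S'S /S_gt1.
Qed.

Lemma same_eigenvalues_exists f : G f -> exists2 h, H h & same_eigenvalues f h.
Proof.
move=> /fixing[fu fs [c cP fc]]; have cQ := multiplicative_on_sub Q_sub cP.
have [h [ha hv ht]] := gauge_aut_exists QQ cQ.
have [chi chiQ chiE] := multiplicative_dual Q_mon Q_gt0 cQ.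
exists h; first by split=> //; exists chi => //; split=> // q Qq; rewrite chiE // ht.
split=> //; first exact: ha.1.
by move=> q Qq; exists (c q); [apply: fc; exact: Q_sub | exact: ht].
Qed.

Lemma same_eigenvalues_surj h : H h -> exists2 f, G f & same_eigenvalues f h.
Proof.
move=> [[hh hb] [chi chiQ [hv ht]]].
have cQ := dual_multiplicative Q_mon chiQ.
have [c [cP cE c1]] := multiplicative_extend S_gt1 S_coprime S'S cQ.
have [f [fa fu fs]] := gauge_aut_exists QP cP.
exists f.
  split=> // x; apply: (star_hom_eq_generated fa.1 (star_hom_id A)).
  move=> _ [p [k [S'p _ ->]]] /=; have Pp : P p.
    by apply: sub_monoid_generated; exact: S'S.
  by rewrite (star_homM _ _ fa.1) (star_homX _ _ fa.1) fu fs // c1 // scale1r.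
split=> // q Qq; exists (chi q%:R); last exact: ht.
by rewrite fs ?cE //; exact: Q_sub.
Qed.

(** An automorphism in the group fixes [s_p] for [p] in [S'], so its character on
    [S \ S'] determines it. *)
Lemma same_eigenvalues_inj f f' h : G f -> G f' ->
  same_eigenvalues f h -> same_eigenvalues f' h -> f = f'.
Proof.
move=> Gf Gf' [_ _ ht] [_ _ ht']; have [fu fs _] := fixing Gf.
have [f'u f's _] := fixing Gf'; have [[[fh _] _] [[f'h _] _]] := (Gf, Gf').
apply: star_hom_ext_gen => //; first by rewrite fu.
move=> p Sp; case: (pselect (S' p)) => S'p; first by rewrite fs ?f's.
have Qp : Q p by apply: sub_monoid_generated.
have [c -> hc] := ht p Qp; have [c' -> hc'] := ht' p Qp.
by congr (_ *: _); apply: (gen_scale_inj QQ Qp); rewrite -hc.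
Qed.

Lemma torsion_fixing_isomorphic : group_isomorphic G H.
Proof.
have /choice[Phi PhiP] (f : A -> A) : exists h,
    forall h', same_eigenvalues f h' -> h = h'.
  case: (pselect (exists h, same_eigenvalues f h)) => [[h fh]|nh].
    by exists h => h'; exact: same_eigenvalues_unique.
  by exists idfun => h' fh'; case: nh; exists h'.
have PhiE f h : same_eigenvalues f h -> Phi f = h by exact: PhiP.
have PhiG f : G f -> H (Phi f) /\ same_eigenvalues f (Phi f).
  by move=> /same_eigenvalues_exists[h Hh fh]; rewrite (PhiE _ _ fh).
exists Phi; split; first split.
- by move=> f /PhiG[].
- move=> f f'; rewrite !inE => Gf Gf' E.
  apply: (same_eigenvalues_inj Gf Gf' (h := Phi f)); first by have [] := PhiG _ Gf.
  by rewrite E; have [] := PhiG _ Gf'.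
- move=> h /same_eigenvalues_surj[f Gf fh]; exists f => //; exact: PhiE.
- move=> f f' Gf Gf'; apply: PhiE; have [[fh _] _] := Gf.
  by apply: same_eigenvalues_comp => //; [have [] := PhiG _ Gf | have [] := PhiG _ Gf'].
Qed.

End Correspondence.
End Main.

Local Open Scope classical_set_scope.

Theorem corollary6p12 (R : realType) (S : set nat)
  (S_gt1 : forall p, S p -> (1 < p)%N)
  (S_coprime : forall p q, S p -> S q -> p <> q -> coprime p q)
  (A : cstarAlgType R) (u : A) (s : nat -> A)
  (QP : boundary_quotient (monoid_generated S) u s) :
  (forall (S' : set nat), S' !=set0 -> S' `<=` S ->
   forall (B : cstarAlgType R) (v : B) (t : nat -> B),
   boundary_quotient (monoid_generated (S `\` S')) v t ->
   group_isomorphic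
     (star_aut_fixing (torsion_subalgebra S' u s))
     (gauge_automorphisms (monoid_generated (S `\` S')) v t))
  /\
  (S !=set0 -> star_aut_fixing (torsion_subalgebra S u s) = [set idfun]).
Proof.
split; last exact: torsion_fixing_trivial.
by move=> S' S'0 S'S B v t QQ; exact: torsion_fixing_isomorphic.
Qed.
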